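(* Let $M$ be a smooth manifold and let $B\in\Gamma(\mathrm T^*M\otimes \mathrm T^*M)$ be a non-degenerate tensor field with skew-symmetric part $\omega$ and symmetric part $S$, such that $\mathrm TM=\mathcal H\oplus\mathcal V$, where $\mathcal H=\operatorname{Ker}S$ and $\mathcal V=\operatorname{Ker}\omega$ are vector subbundles. Then the associated bivector field $\Lambda=-(\mathsf\Lambda^2\widehat B^{-1})(\omega)$ defines a Poisson structure if, and only if, the following conditions hold: (i) the exterior derivative of $\omega$ vanishes on the horizontal distribution, i.e. $(\mathsf\Lambda^3\,{}^{t}\mathrm{pr}_{\mathcal H})(\mathrm d\omega)=0$; (ii) the horizontal distribution $\mathcal H$ is integrable.
   Context: Manifolds are smooth and paracompact, and all objects are smooth. For a 2-covariant tensor field $T$, $\widehat T(v)=T(v,\cdot)$ as a map $\mathrm TM\to \mathrm T^*M$; $\operatorname{Ker}T$ means $\operatorname{Ker}\widehat T$. $B$ is non-degenerate if $\widehat B$ is an isomorphism. $\omega(u,v)=\frac12(B(u,v)-B(v,u))$, $S(u,v)=\frac12(B(u,v)+B(v,u))$. Explicitly, $\Lambda(\alpha,\beta)=-\omega(\widehat B^{-1}(\alpha),\widehat B^{-1}(\beta))$ for $\alpha,\beta\in\Omega^1(M)$. $\mathrm{pr}_{\mathcal H}$ is the projection onto $\mathcal H$ along $\mathcal V$, and $\big((\mathsf\Lambda^3\,{}^{t}\mathrm{pr}_{\mathcal H})(\gamma)\big)(X,Y,Z)=\gamma(\mathrm{pr}_{\mathcal H}X,\mathrm{pr}_{\mathcal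 H}Y,\mathrm{pr}_{\mathcal H}Z)$. A bivector field $\Lambda$ defines a Poisson structure if $[\Lambda,\Lambda]=0$ for the Schouten–Nijenhuis bracket (equivalently, $\{f,g\}=\Lambda(\mathrm df,\mathrm dg)$ satisfies the Jacobi identity). *)

(* Defs.v *)
From HB Require Import structures.
From mathcomp Require Import all_boot all_order all_algebra.
From mathcomp Require Import all_classical all_reals all_analysis.

Set Implicit Arguments.
Unset Strict Implicit.
Unset Printing Implicit Defensive.

Import Order.TTheory GRing.Theory Num.Theory.
Import numFieldNormedType.Exports.

Local Open Scope classical_set_scope.
Local Open Scope ring_scope.

(* Class C^k on an open set U: f is Frechet differentiable at every point of U
   and each of its directional derivatives is of class C^(k-1).  Only the values
   of f on U matter. *)
Fixpoint class_C (R : realType) (V W : normedModType R) (k : nat) (U : set V)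
    (f : V -> W) : Prop :=
  if k is k'.+1 then
    (forall x, U x -> differentiable f x) /\
    (forall v, class_C k' U (fun x => 'D_v f x))
  else forall x, U x -> {for x, continuous f}.

Definition smooth_on (R : realType) (V W : normedModType R) (U : set V)
    (f : V -> W) : Prop :=
  forall k, class_C k U f.

Definition paracompact_space (T : topologicalType) : Prop :=
  forall F : set (set T),
    (forall A, F A -> open A) -> \bigcup_(A in F) A = setT ->
  exists G : set (set T),
    [/\ forall A, G A -> open A /\ (exists2 A', F A' & A `<=` A'),
        \bigcup_(A in G) A = setT
      & forall x : T, exists2 N, nbhs x N &
          finite_set [set A | G A /\ A `&` N !=set0]].

(* A smooth n-manifold: a paracompact Hausdorff space with a smooth atlas (not
   necessarily maximal).  [coord c] is the coordinate map of the chart c, of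
   domain [dom c], and [param c] is its inverse; both are total functions, whose
   values outside [dom c] and [coord c @` dom c] are irrelevant. *)
Record manifold (R : realType) (n : nat) := Manifold {
  carrier :> topologicalType;
  chart : Type;
  dom : chart -> set carrier;
  coord : chart -> carrier -> 'rV[R]_n;
  param : chart -> 'rV[R]_n -> carrier;
  manifold_hausdorff : hausdorff_space carrier;
  manifold_paracompact : paracompact_space carrier;
  dom_open : forall c, open (dom c);
  dom_cover : forall p, exists c, dom c p;
  coord_open : forall c, open (coord c @` dom c);
  coord_cont : forall c p, dom c p -> {for p, continuous (coord c)};
  coordK : forall c p, dom c p -> param c (coord c p) = p;
  param_cont : forall c x, (coord c @` dom c) x -> {for x, continuous (param c)};
  transition_smooth : forall c d,
    smooth_on (coord c @` (dom c `&` dom d)) (coord d \o param c)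
}.

Arguments chart {R n} m.
Arguments dom {R n m} c.
Arguments coord {R n m} c.
Arguments param {R n m} c.

Section Tensors.
Variables (R : realType) (n : nat) (M : manifold R n).

Definition chart_image (c : chart M) : set 'rV[R]_n := coord c @` dom c.

(* Tensor fields are given by their components in every chart, as functions on
   the image of the chart.  Tangent vectors and covectors are row vectors of
   components; the matrix A of a bilinear form is A a b = T(e_a, e_b), so that
   T(u, v) = u *m A *m v^T and the covector T(u, .) is u *m A. *)
Definition components := chart M -> 'rV[R]_n -> 'M[R]_n.

Definition bil (A : 'M[R]_n) (u v : 'rV[R]_n) : R := (u *m A *m v^T) 0 0.

(* Smooth sections of T^*M (x) T^*M.  The Jacobian matrix [J] of the coordinate
   change acts on row vectors, i.e. J a b = d y^b / d x^a. *)
Record tensor02 := Tensor02 {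
  comp :> components;
  comp_smooth : forall c, smooth_on (chart_image c) (comp c);
  comp_change : forall c d p, dom c p -> dom d p ->
    let J := jacobian (coord d \o param c) (coord c p) in
    comp c (coord c p) = J *m comp d (coord d p) *m J^T
}.

Definition tensor_nondegenerate (B : components) : Prop :=
  forall c x, chart_image c x -> B c x \in unitmx.

Definition skew_part (B : components) : components :=
  fun c x => 2%:R^-1 *: (B c x - (B c x)^T).

Definition sym_part (B : components) : components :=
  fun c x => 2%:R^-1 *: (B c x + (B c x)^T).

(* A distribution (field of subspaces of the tangent spaces) is given in each
   chart by the row space of a matrix. *)
Definition Ker (T : components) : components := fun c x => kermx (T c x).

(* Vector subbundle of TM: there are smooth local frames around every point. *)
Definition subbundle (D : components) : Prop :=
  forall c x, chart_image c x ->
  exists (k : nat) (W : set 'rV[R]_n) (E : 'rV[R]_n -> 'M[R]_(k, n)),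
    [/\ open W, W x, W `<=` chart_image c, smooth_on W E
      & forall y, W y -> row_free (E y) /\ (E y == D c y)%MS].

Definition tangent_direct_sum (D1 D2 : components) : Prop :=
  forall c x, chart_image c x ->
    (D1 c x :&: D2 c x == (0 : 'M[R]_n))%MS /\ row_full (D1 c x + D2 c x)%MS.

(* The projection onto D1 along D2, acting on row vectors by u *m _. *)
Definition pr (D1 D2 : components) : components :=
  fun c x => proj_mx (D1 c x) (D2 c x).

Definition ext_deriv (w : components) (c : chart M) (x X Y Z : 'rV[R]_n) : R :=
  bil ('D_X (w c) x) Y Z + bil ('D_Y (w c) x) Z X + bil ('D_Z (w c) x) X Y.

Definition vanishes_along (P : components)
    (g : chart M -> 'rV[R]_n -> 'rV[R]_n -> 'rV[R]_n -> 'rV[R]_n -> R) : Prop :=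
  forall c x, chart_image c x -> forall X Y Z,
    g c x (X *m P c x) (Y *m P c x) (Z *m P c x) = 0.

(* Lambda(alpha, beta) = - omega(B^-1 alpha, B^-1 beta), where
   B^-1 alpha = alpha *m invmx B. *)
Definition assoc_bivector (B : components) : components :=
  fun c x => - (invmx (B c x) *m skew_part B c x *m (invmx (B c x))^T).

(* Schouten-Nijenhuis bracket of two bivector fields P, Q, evaluated on three
   covectors: it is the cyclic sum over (a, b, c) of
   P^(ad) d_d Q^(bc) + Q^(ad) d_d P^(bc), up to a global sign convention. *)
Definition schouten (P Q : components) (c : chart M)
    (x al be ga : 'rV[R]_n) : R :=
  let half (S T : components) (u v w : 'rV[R]_n) :=
    bil ('D_(u *m S c x) (T c) x) v w in
  half P Q al be ga + half P Q be ga al + half P Q ga al be +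
  (half Q P al be ga + half Q P be ga al + half Q P ga al be).

Definition is_poisson (L : components) : Prop :=
  forall c x, chart_image c x -> forall al be ga, schouten L L c x al be ga = 0.

(* s : U -> M is a smooth injective immersion of an open subset U of R^k whose
   tangent space at each point is the subspace given by D. *)
Definition integral_manifold (D : components) (k : nat) (U : set 'rV[R]_k)
    (s : 'rV[R]_k -> M) : Prop :=
  [/\ open U,
      forall u, U u -> {for u, continuous s},
      forall u v, U u -> U v -> s u = s v -> u = v,
      forall c, smooth_on (U `&` s @^-1` dom c) (coord c \o s)
    & forall c u, U u -> dom c (s u) ->
        row_free (jacobian (coord c \o s) u) /\
        (jacobian (coord c \o s) u == D c (coord c (s u)))%MS].

(* Through every point of M passes an integral manifold of D. *)
Definition integrable_distribution (D : components) : Prop :=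
  forall p : M, exists (k : nat) (U : set 'rV[R]_k) (s : 'rV[R]_k -> M),
    integral_manifold D U s /\ (s @` U) p.

End Tensors.

(* Main.v *)
Require Import Defs.
From mathcomp Require Import all_boot all_order all_algebra.
From mathcomp Require Import all_classical all_reals all_analysis.
From mathcomp Require Import ring lra.

Set Implicit Arguments.
Unset Strict Implicit.
Unset Printing Implicit Defensive.

Import Order.TTheory GRing.Theory Num.Theory.
Import numFieldNormedType.Exports.

Local Open Scope classical_set_scope.
Local Open Scope ring_scope.

(** Everything is read in a chart, where B, its skew part w, its symmetric part
    S and the bivector L are matrices acting on row vectors.  Since
    TM = H + V with H = Ker S and V = Ker w, the map B restricts to w on H and
    to S on V; hence w L is the projection P onto H along V
    ([projector_bivector]), and w and L are generalised inverses of each other.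

    A covector splits as X w + xi with X in H and xi L = 0.  Differentiating
    L w L = L, w L w = w and P = w L turns the Schouten bracket into a sum of
    pieces ([jacobiator_eq0P]): on three covectors X w, Y w, Z w it is
    dw(X, Y, Z); on X w, Y w, xi it is the pairing of xi with
    Y D_X P - X D_Y P; with two or three xi it vanishes.  So L is Poisson if
    and only if dw vanishes on H and, at every point, Y D_X P = X D_Y P for all
    X, Y in H ([poissonP]).  The second condition, called [involutive_at] below,
    is the involutivity of H in a form that mentions no vector field.  It
    remains to see that it is equivalent to integrability.

    If F parametrises an integral manifold, then (D_h F) P(F) = D_h F.
    Differentiating along g and antisymmetrising, the second derivatives of F
    cancel by symmetry ([derive_sym]) and the condition on P is left
    ([involutive_of_integral]).

    The converse is the Frobenius theorem.  A local frame of H is rescaled to a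
    frame E with E pi = 1 for a constant matrix pi; involutivity then makes the
    rows of E commuting vector fields ([frobenius_frame]).  The integral
    manifold is u |-> sigma(u) = z(1), where z' = u E(z) and z(0) = x0.  For
    small h the curve z(t) + t h E(z(t)) solves the equation of u + h up to
    O(|h|^2), because the rows of E commute; a Gronwall estimate then gives
    D_h sigma = h E(sigma) ([flow_map]).  Smoothness of sigma follows from this
    equation by bootstrapping ([smooth_of_derive]), and sigma is injective
    because sigma(u) pi = x0 pi + u.  The curves themselves come from Picard
    iteration ([picard]). *)

(** * Differentials of matrix-valued maps *)

Section Differentials.
Context {R : realType}.
Implicit Types V W : normedModType R.

Lemma differentiable_linear_approx V W (f : V -> W) (x : V)
    (df : {linear V -> W}) : continuous df ->
  (forall e, 0 < e -> \forall h \near (0 : V),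
     `|f (h + x) - f x - df h| <= e * `|h|) ->
  differentiable f x /\ 'd f x = df :> (V -> W).
Proof.
move=> cdf fdf.
have E : f \o shift x = cst (f x) + df +o_0 id.
  apply/eqaddoP => e e0; near=> h.
  have -> : (f \o shift x - (cst (f x) + df)) h = f (h + x) - f x - df h.
    by rewrite opprD addrA.
  by near: h; exact: fdf.
have dfE := diff_unique cdf E; split=> //.
by apply/diff_locallyP; rewrite dfE.
Unshelve. all: by end_near. Qed.

Lemma differentiable_approx V W (f : V -> W) (x : V) : differentiable f x ->
  forall e, 0 < e -> \forall h \near (0 : V),
     `|f (h + x) - f x - 'd f x h| <= e * `|h|.
Proof.
move=> /diff_locallyP[_ /eqaddoP E] e e0; near=> h.
have -> : f (h + x) - f x - 'd f x h = (f \o shift x - (cst (f x) + 'd f x)) h.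
  by rewrite [RHS]/= opprD addrA.
by near: h; exact: E.
Unshelve. all: by end_near. Qed.

Lemma near_differentiable V W (f g : V -> W) (x : V) :
  {near x, f =1 g} -> differentiable f x -> differentiable g x.
Proof.
move=> fg df; have cdf : continuous ('d f x) by exact: diff_continuous.
apply: (proj1 (differentiable_linear_approx cdf _)).
move=> e e0; have := differentiable_approx df e0.
move=> H; near=> h.
have <- : f x = g x by exact: nbhs_singleton fg.
have <- : f (h + x) = g (h + x).
  near: h; move: fg; rewrite (near_shift 0) => fg.
  by apply: filterS fg => h; rewrite /= subr0.
by near: h.
Unshelve. all: by end_near. Qed.

Lemma derive_comp V W (U : normedModType R) (f : V -> W) (g : W -> U) x v :
  differentiable f x -> differentiable g (f x) ->
  'D_v (g \o f) x = 'D_('D_v f x) g (f x).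
Proof.
move=> df dg; rewrite !deriveE//; last exact: differentiable_comp.
by rewrite diff_comp.
Qed.

Lemma derive_scalev V W (f : V -> W) x a u : differentiable f x ->
  'D_(a *: u) f x = a *: 'D_u f x.
Proof. by move=> df; rewrite !deriveE// linearZ. Qed.

Lemma derive_row n W (f : 'rV[R]_n -> W) x v : differentiable f x ->
  'D_v f x = \sum_j v 0 j *: 'D_(delta_mx 0 j) f x.
Proof.
move=> df; rewrite deriveE// [X in 'd f x X]row_sum_delta linear_sum.
by apply: eq_bigr => j _; rewrite linearZ deriveE.
Qed.

Lemma differentiable_mxP V m n (f : V -> 'M[R]_(m, n)) x :
  differentiable f x <-> forall i j, differentiable (fun y => f y i j) x.
Proof.
split=> [df i j|df].
  apply: (differentiable_comp (g := fun N : 'M[R]_(m, n) => N i j)) => //.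
  exact: differentiable_coord.
have -> : f = \sum_i \sum_j (fun y => f y i j *: delta_mx i j).
  apply/funext => y; rewrite fct_sumE [LHS]matrix_sum_delta.
  by apply: eq_bigr => i _; rewrite fct_sumE.
apply: differentiable_sum => i; apply: differentiable_sum => j.
exact: differentiableZl.
Qed.

Lemma derive_mx_coord V m n (f : V -> 'M[R]_(m, n)) x v i j :
  differentiable f x -> ('D_v f x) i j = 'D_v (fun y => f y i j) x.
Proof. by move=> df; rewrite derive_mx ?mxE//; exact: diff_derivable. Qed.

Lemma derive_trmx V m n (f : V -> 'M[R]_(m, n)) x v : differentiable f x ->
  'D_v (fun y => (f y)^T) x = ('D_v f x)^T.
Proof.
move=> df; have /differentiable_mxP dfc := df; apply/matrixP => i j.
have E : (fun y => (f y)^T i j) = (fun y => f y j i).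
  by apply/funext => y; rewrite mxE.
rewrite mxE !derive_mx_coord ?E//; apply/differentiable_mxP => i' j'.
rewrite (_ : (fun y => _) = (fun y => f y j' i')); first exact: dfc.
by apply/funext => y; rewrite mxE.
Qed.

Lemma differentiable_mulmx V m n p (f : V -> 'M[R]_(m, n))
    (g : V -> 'M[R]_(n, p)) x :
  differentiable f x -> differentiable g x ->
  differentiable (fun y => f y *m g y) x.
Proof.
move=> /differentiable_mxP df /differentiable_mxP dg.
apply/differentiable_mxP => i j.
rewrite (_ : (fun y => _) =
    \sum_l ((fun y => f y i l) * (fun y => g y l j))); last first.
  by apply/funext => y; rewrite mxE fct_sumE.
apply: differentiable_sum => l; exact: (differentiableM (df i l) (dg l j)).
Qed.

Lemma derive_mulmx V m n p (f : V -> 'M[R]_(m, n)) (g : V -> 'M[R]_(n, p)) x v :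
  differentiable f x -> differentiable g x ->
  'D_v (fun y => f y *m g y) x = 'D_v f x *m g x + f x *m 'D_v g x.
Proof.
move=> df dg; have /differentiable_mxP dfc := df.
have /differentiable_mxP dgc := dg; apply/matrixP => i j.
have fgE : (fun y => (f y *m g y) i j) =
    \sum_l ((fun y => f y i l) * (fun y => g y l j)).
  by apply/funext => y; rewrite mxE fct_sumE.
have dfg l : differentiable ((fun y => f y i l) * (fun y => g y l j)) x.
  exact: (differentiableM (dfc i l) (dgc l j)).
rewrite derive_mx_coord; last exact: differentiable_mulmx.
rewrite fgE derive_sum; last by move=> l; exact: diff_derivable.
rewrite !mxE -big_split; apply: eq_bigr => l _ /=.
rewrite deriveM; [|exact: diff_derivable|exact: diff_derivable].
rewrite !(derive_mx_coord _ _ _ df) !(derive_mx_coord _ _ _ dg) addrC.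
by congr (_ + _); exact: mulrC.
Qed.

Lemma ler_mx_coord m n (A : 'M[R]_(m, n)) i j : `|A i j| <= `|A|.
Proof.
rewrite [leRHS]/Num.Def.normr/= mx_normrE.
exact: (le_bigmax _ (fun ij : 'I_m * 'I_n => `|A ij.1 ij.2|) (i, j)).
Qed.

Lemma mx_norm_le m n (A : 'M[R]_(m, n)) c : 0 <= c ->
  (forall i j, `|A i j| <= c) -> `|A| <= c.
Proof.
move=> c0 Ac; rewrite [leLHS]/Num.Def.normr/= mx_normrE.
by apply: bigmax_le => // -[i j] _; exact: Ac.
Qed.

Lemma norm_mulmx_le m n p (A : 'M[R]_(m, n)) (B : 'M[R]_(n, p)) :
  `|A *m B| <= n%:R * (`|A| * `|B|).
Proof.
apply: mx_norm_le => [|i j]; first by rewrite !mulr_ge0.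
rewrite mxE (le_trans (ler_norm_sum _ _ _))//.
have -> : n%:R * (`|A| * `|B|) = \sum_(k < n) `|A| * `|B|.
  by rewrite sumr_const card_ord mulr_natl.
by apply: ler_sum => k _; rewrite normrM ler_pM// ler_mx_coord.
Qed.

Lemma differentiable_mulmxr m n p (B : 'M[R]_(n, p)) A :
  differentiable (fun A : 'M[R]_(m, n) => A *m B) A.
Proof.
apply/differentiable_mxP => i j.
rewrite (_ : (fun _ => _) =
    \sum_k (fun C : 'M[R]_(m, n) => C i k *: (B k j : R^o))); last first.
  by apply/funext => C; rewrite mxE fct_sumE.
apply: differentiable_sum => k; apply: differentiableZl.
exact: differentiable_coord.
Qed.

End Differentials.

(** * Functions of class C^k *)

Section ClassC.
Context {R : realType}.
Implicit Types V W : normedModType R.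

Lemma class_CW V W k (U : set V) (f : V -> W) :
  class_C k.+1 U f -> class_C k U f.
Proof.
elim: k f => [f [df _] x Ux|k IH f [df dvf]].
  exact: differentiable_continuous (df x Ux).
by split=> // v; exact/IH/dvf.
Qed.

Lemma class_C_sub V W k (U U' : set V) (f : V -> W) : U' `<=` U ->
  class_C k U f -> class_C k U' f.
Proof.
move=> sU; elim: k f => [f + x /sU|k IH f [df dvf]]; first exact.
by split=> [x /sU|v]; [exact: df|exact/IH/dvf].
Qed.

(** The hypothesis that U is open is essential: a derivative only depends on the
    germ of the function. *)
Lemma class_C_eq V W k (U : set V) (f g : V -> W) : open U ->
  (forall x, U x -> f x = g x) -> class_C k U f -> class_C k U g.
Proof.
move=> oU; elim: k f g => [|k IH] f g fg.
  move=> cf x Ux; have fgx : g y @[y --> x] --> f x.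
    apply: cvg_trans (cf x Ux); apply: near_eq_cvg.
    by near=> y; rewrite fg//; near: y; exact: open_nbhs_nbhs.
  by move: fgx; rewrite (fg x Ux).
move=> [df dvf].
have near_fg x : U x -> {near x, f =1 g}.
  by move=> Ux; near=> y; apply: fg; near: y; exact: open_nbhs_nbhs.
split=> [x Ux|v]; first exact: near_differentiable (near_fg x Ux) (df x Ux).
apply: IH (dvf v) => x Ux; apply: near_eq_derive; exact: near_fg.
Unshelve. all: by end_near. Qed.

Lemma class_C_cst V W k (U : set V) (a : W) : class_C k U (fun=> a).
Proof.
elim: k a => [|k IH] a; first by move=> x _; exact: cst_continuous.
split=> // v; have -> : (fun x => 'D_v (fun=> a) x) = (fun=> 0) :> (V -> W).
  by apply/funext => x; rewrite derive_cst.
exact: IH.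
Qed.

Lemma class_CD V W k (U : set V) (f g : V -> W) : open U ->
  class_C k U f -> class_C k U g -> class_C k U (fun x => f x + g x).
Proof.
move=> oU; elim: k f g => [|k IH] f g.
  by move=> cf cg x Ux; apply: continuousD; [exact: cf|exact: cg].
move=> [df dvf] [dg dvg]; split=> [x Ux|v].
  by apply: differentiableD; [exact: df|exact: dg].
apply: class_C_eq (IH _ _ (dvf v) (dvg v)) => // x Ux.
by rewrite deriveD//; apply: diff_derivable; [exact: df|exact: dg].
Qed.

Lemma class_CM V k (U : set V) (f g : V -> R) : open U ->
  class_C k U f -> class_C k U g -> class_C k U (fun x => f x * g x).
Proof.
move=> oU; elim: k f g => [|k IH] f g.
  by move=> cf cg x Ux; apply: continuousM; [exact: cf|exact: cg].
move=> cf cg; have [df dvf] := cf; have [dg dvg] := cg; split=> [x Ux|v].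
  by apply: differentiableM; [exact: df|exact: dg].
have := class_CD oU (IH _ _ (class_CW cf) (dvg v)) (IH _ _ (class_CW cg) (dvf v)).
apply: class_C_eq => // x Ux.
by rewrite deriveM//; apply: diff_derivable; [exact: df|exact: dg].
Qed.

Lemma class_C_sum V k (U : set V) (I : Type) (r : seq I) (P : pred I)
    (f : I -> V -> R) : open U ->
  (forall i, class_C k U (f i)) ->
  class_C k U (fun x => \sum_(i <- r | P i) f i x).
Proof.
move=> oU cf; elim: r => [|i r IH].
  rewrite (_ : (fun _ => _) = fun=> 0); first exact: class_C_cst.
  by apply/funext => x; rewrite big_nil.
rewrite (_ : (fun _ => _) = fun x => if P i then
    f i x + \sum_(j <- r | P j) f j x else \sum_(j <- r | P j) f j x).
  by case: (P i) => //; exact: class_CD.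
by apply/funext => x; rewrite big_cons.
Qed.

Lemma class_C_prod V k (U : set V) (I : Type) (r : seq I) (P : pred I)
    (f : I -> V -> R) : open U ->
  (forall i, class_C k U (f i)) ->
  class_C k U (fun x => \prod_(i <- r | P i) f i x).
Proof.
move=> oU cf; elim: r => [|i r IH].
  rewrite (_ : (fun _ => _) = fun=> 1); first exact: class_C_cst.
  by apply/funext => x; rewrite big_nil.
rewrite (_ : (fun _ => _) = fun x => if P i then
    f i x * \prod_(j <- r | P j) f j x else \prod_(j <- r | P j) f j x).
  by case: (P i) => //; exact: class_CM.
by apply/funext => x; rewrite big_cons.
Qed.

(** D_v (1/f) = - (1/f)^2 D_v f expresses the derivative through 1/f itself, so
    the regularity of 1/f bootstraps. *)
Lemma class_CV V k (U : set V) (f : V -> R) : open U ->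
  (forall x, U x -> f x != 0) ->
  class_C k U f -> class_C k U (fun x => (f x)^-1).
Proof.
move=> oU f0; elim: k => [|k IH].
  by move=> cf x Ux; apply: continuousV; [exact: f0|exact: cf].
move=> cf; have [df dvf] := cf; split=> [x Ux|v].
  by apply: differentiableV; [exact: df|exact: f0].
have cV := IH (class_CW cf).
have := class_CM oU (class_C_cst k U (-1 : R)) (class_CM oU (class_CM oU cV cV) (dvf v)).
apply: class_C_eq => // x Ux.
rewrite deriveV//; [|exact: f0|exact/diff_derivable/df].
by rewrite /GRing.scale/= mulN1r expr2 invfM mulNr.
Qed.

Lemma class_C_mxP V k (U : set V) m n (f : V -> 'M[R]_(m, n)) : open U ->
  class_C k U f <-> forall i j, class_C k U (fun x => f x i j).
Proof.
move=> oU; elim: k f => [|k IH] f; split.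
- move=> cf i j x Ux.
  apply: (continuous_comp (g := fun N : 'M[R]_(m, n) => N i j)); first exact: cf.
  exact: coord_continuous.
- move=> cf x Ux; apply/cvgrPdist_le => e e0.
  have E : \forall y \near x, forall i j, `|f x i j - f y i j| <= e.
    apply: filter_forall => i; apply: filter_forall => j.
    by have /cvgrPdist_le := cf i j x Ux; exact.
  near=> y; apply: mx_norm_le => [|i j]; first exact: ltW.
  by rewrite !mxE; move: i j; near: y.
- move=> [df dvf] i j; split=> [x Ux|v].
    by have /differentiable_mxP := df x Ux; exact.
  have /IH/(_ i j) := dvf v; apply: class_C_eq => // x Ux.
  exact/derive_mx_coord/df.
- move=> cf; have df x : U x -> differentiable f x.
    by move=> Ux; apply/differentiable_mxP => i j; exact: (cf i j).1.
  split=> // v; apply/IH => i j.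
  apply: class_C_eq ((cf i j).2 v) => // x Ux.
  by rewrite derive_mx_coord//; exact: df.
Unshelve. all: by end_near. Qed.

Lemma class_C_mulmx V k (U : set V) m n p (f : V -> 'M[R]_(m, n))
    (g : V -> 'M[R]_(n, p)) : open U ->
  class_C k U f -> class_C k U g -> class_C k U (fun x => f x *m g x).
Proof.
move=> oU /class_C_mxP-/(_ oU) cf /class_C_mxP-/(_ oU) cg.
apply/class_C_mxP => // i j.
have : class_C k U (fun x => \sum_l f x i l * g x l j).
  by apply: class_C_sum => // l; exact: class_CM.
by apply: class_C_eq => // x _; rewrite mxE.
Qed.

Lemma class_C_addmx V k (U : set V) m n (f g : V -> 'M[R]_(m, n)) : open U ->
  class_C k U f -> class_C k U g -> class_C k U (fun x => f x + g x).
Proof. by move=> oU cf cg; apply: class_CD. Qed.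

Lemma class_C_scale V k (U : set V) m n (a : R) (f : V -> 'M[R]_(m, n)) :
  open U -> class_C k U f -> class_C k U (fun x => a *: f x).
Proof.
move=> oU /class_C_mxP-/(_ oU) cf; apply/class_C_mxP => // i j.
have := class_CM oU (class_C_cst k U a) (cf i j).
by apply: class_C_eq => // x _; rewrite mxE.
Qed.

Lemma class_C_trmx V k (U : set V) m n (f : V -> 'M[R]_(m, n)) :
  open U -> class_C k U f -> class_C k U (fun x => (f x)^T).
Proof.
move=> oU /class_C_mxP-/(_ oU) cf; apply/class_C_mxP => // i j.
by apply: class_C_eq (cf j i) => // x _; rewrite mxE.
Qed.

Lemma class_C_det V k (U : set V) n (f : V -> 'M[R]_n) :
  open U -> class_C k U f -> class_C k U (fun x => \det (f x)).
Proof.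
move=> oU /class_C_mxP-/(_ oU) cf.
by apply: class_C_sum => // s; apply: class_CM => //;
  [exact: class_C_cst|exact: class_C_prod].
Qed.

(** Cramer's rule reduces inversion to determinants. *)
Lemma class_C_invmx V k (U : set V) n (f : V -> 'M[R]_n) : open U ->
  (forall x, U x -> f x \in unitmx) ->
  class_C k U f -> class_C k U (fun x => invmx (f x)).
Proof.
move=> oU uf cf.
have c1 : class_C k U (fun x => (\det (f x))^-1).
  apply: class_CV => //; last exact: class_C_det.
  by move=> x /uf; rewrite unitmxE unitfE.
have c2 : class_C k U (fun x => \adj (f x)).
  apply/class_C_mxP => // i j.
  have : class_C k U (fun x => (-1) ^+ (j + i) * \det (row' j (col' i (f x)))).
    apply: class_CM => //; first exact: class_C_cst.
    apply: class_C_det => //; apply/class_C_mxP => // i' j'.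
    move/class_C_mxP : cf => /(_ oU) /(_ (lift j i') (lift i j')).
    by apply: class_C_eq => // x _; rewrite !mxE.
  by apply: class_C_eq => // x _; rewrite mxE.
apply/class_C_mxP => // i j; move/class_C_mxP : c2 => /(_ oU) /(_ i j) c2.
apply: class_C_eq (class_CM oU c1 c2) => // x Ux.
by rewrite /invmx uf// [RHS]mxE.
Qed.

(** Induction on k through the chain rule in coordinates: D_v (g o f) is the sum
    over j of (D_v f)_j times (D_j g) o f, and the induction hypothesis applies to
    each D_j g. *)
Lemma class_C_comp V n k (U : set V) (U' : set 'rV[R]_n)
    (f : V -> 'rV[R]_n) (g : 'rV[R]_n -> R) :
  open U -> (forall x, U x -> U' (f x)) ->
  class_C k U f -> class_C k U' g -> class_C k U (g \o f).
Proof.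
move=> oU fU; elim: k f g fU => [|k IH] f g fU.
  by move=> cf cg x Ux; apply: continuous_comp; [exact: cf|exact/cg/fU].
move=> cf cg; have [df dvf] := cf; have [dg dvg] := cg; split=> [x Ux|v].
  by apply: differentiable_comp; [exact: df|exact/dg/fU].
have : class_C k U
    (fun x => \sum_j ('D_v f x) 0 j * ('D_(delta_mx 0 j) g \o f) x).
  apply: class_C_sum => // j; apply: class_CM => //.
    by have /class_C_mxP-/(_ oU) := dvf v; exact.
  by apply: IH (class_CW cf) (dvg _).
apply: class_C_eq => // x Ux.
rewrite [RHS]derive_comp; [|exact: df|exact/dg/fU].
by rewrite derive_row//; exact/dg/fU.
Qed.

Lemma class_C_comp_mx V n p q k (U : set V) (U' : set 'rV[R]_n)
    (f : V -> 'rV[R]_n) (g : 'rV[R]_n -> 'M[R]_(p, q)) :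
  open U -> open U' -> (forall x, U x -> U' (f x)) ->
  class_C k U f -> class_C k U' g -> class_C k U (g \o f).
Proof.
move=> oU oU' fU cf /class_C_mxP-/(_ oU') cg; apply/class_C_mxP => // i j.
exact: (@class_C_comp _ n k U U' f (fun y => g y i j)).
Qed.

End ClassC.

(** * Mean values and second derivatives *)

Section MeanValue.
Context {R : realType}.

Lemma differentiable_line (V : normedModType R) (x v : V) (t : R) :
  differentiable (fun s : R => x + s *: v) t.
Proof.
apply: differentiableD; first exact: differentiable_cst.
exact: (differentiableZl (k := id)).
Qed.

Lemma derive_line (V : normedModType R) (x v : V) (t : R) :
  'D_1 (fun s : R => x + s *: v) t = v.
Proof.
rewrite deriveE; last exact: differentiable_line.
have H : is_diff t (cst x + ( *:%R ^~ v)) (0 + ( *:%R ^~ v)).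
  by apply: is_diffD.
by rewrite [X in X _ = _](@diff_val _ _ _ _ _ _ _ H) /= fctE scale1r add0r.
Qed.

Lemma MVT_line (V : normedModType R) (f : V -> R) (x v : V) :
  (forall t : R, 0 <= t <= 1 -> differentiable f (x + t *: v)) ->
  exists2 t : R, 0 <= t <= 1 & f (x + v) - f x = 'D_v f (x + t *: v).
Proof.
move=> df.
have dg (t : R) : 0 <= t <= 1 -> is_derive t 1 (fun s : R => f (x + s *: v))
    ('D_v f (x + t *: v)).
  move=> t01; have dl := differentiable_line x v t.
  apply: DeriveDef.
    apply: diff_derivable.
    exact: (differentiable_comp (g := f) dl (df t t01)).
  rewrite (derive_comp (f := fun s : R => x + s *: v) (g := f) _ dl (df t t01)).
  by rewrite derive_line.
have [||t t01] := @MVT R (fun s : R => f (x + s *: v))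
    (fun t : R => 'D_v f (x + t *: v)) 0 1 ltr01.
- by move=> t; rewrite in_itv/= => /andP[t0 t1]; apply: dg; rewrite !ltW.
- apply: derivable_within_continuous => t; rewrite in_itv/= => t01.
  by have [] := dg t t01.
rewrite scale1r scale0r addr0 subr0 mulr1 => E; exists t => //.
by move: t01; rewrite in_itv/= => /andP[t0 t1]; rewrite !ltW.
Qed.

(** The mean value theorem is applied twice: along v to the increment of f in
    direction w, then along w to D_v f. *)
Lemma second_difference (V : normedModType R) (U : set V) (f : V -> R)
    (x v w : V) (s : R) : class_C 2 U f -> 0 < s ->
  (forall a b : R, 0 <= a <= s -> 0 <= b <= s -> U (x + a *: v + b *: w)) ->
  exists a b : R, [/\ 0 <= a <= s, 0 <= b <= s &
    f (x + s *: v + s *: w) - f (x + s *: v) - (f (x + s *: w) - f x) =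
    s * s * 'D_w ('D_v f) (x + a *: v + b *: w)].
Proof.
move=> [df dvf] s0 sU.
have ss (t : R) : 0 <= t <= 1 -> 0 <= t * s <= s.
  move=> /andP[t0 t1]; apply/andP; split; last by rewrite ger_pMl.
  by rewrite mulr_ge0// ltW.
have s_s : 0 <= s <= s by rewrite ltW/=.
have z_s : (0 : R) <= 0 <= s by rewrite lexx ltW.
have dfw (t : R) : 0 <= t <= 1 -> differentiable f (x + t *: (s *: v) + s *: w).
  by move=> t01; rewrite scalerA; apply/df/sU => //; exact: ss.
have df0 (t : R) : 0 <= t <= 1 -> differentiable f (x + t *: (s *: v)).
  move=> t01; rewrite scalerA -[_ + _]addr0 -[X in _ + X](scale0r w).
  by apply/df/sU => //; exact: ss.
pose sh (y : V) := y + s *: w.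
have dsh y : is_diff y sh id.
  have H : is_diff y (id + cst (s *: w)) (id + 0) by apply: is_diffD.
  by apply: is_diff_eq; rewrite addr0.
have dfsh (t : R) : 0 <= t <= 1 -> differentiable (f \o sh) (x + t *: (s *: v)).
  move=> t01; apply: differentiable_comp; last exact: dfw.
  exact: (@ex_diff _ _ _ _ _ _ _ (dsh _)).
have [|t t01] := @MVT_line V (f \o sh - f) x (s *: v).
  by move=> t t01; apply: differentiableB; [exact: dfsh|exact: df0].
have dE : 'D_(s *: v) (f \o sh - f) (x + t *: (s *: v)) =
    s * ('D_v f (x + (t * s) *: v + s *: w) - 'D_v f (x + (t * s) *: v)).
  rewrite deriveB; [|exact/diff_derivable/dfsh|exact/diff_derivable/df0].
  rewrite derive_comp; [|exact: (@ex_diff _ _ _ _ _ _ _ (dsh _))|exact: dfw].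
  rewrite (deriveE _ (@ex_diff _ _ _ _ _ _ _ (dsh _))) diff_val/=.
  rewrite !derive_scalev; [|exact: df0|exact: dfw].
  by rewrite /sh/= !scalerA -scalerBr.
rewrite {}dE => E1.
have [|t' t'01] := @MVT_line V ('D_v f) (x + (t * s) *: v) (s *: w).
  by move=> t' t'01; rewrite scalerA; apply: (dvf v).1; apply: sU; exact: ss.
rewrite derive_scalev; last first.
  by rewrite scalerA; apply: (dvf v).1; apply: sU; exact: ss.
rewrite scalerA => E2.
exists (t * s), (t' * s); split; [exact: ss|exact: ss|].
by rewrite E2 in E1; rewrite -mulrA; exact: E1.
Qed.

(** Symmetry of second derivatives: both mixed derivatives are values of the
    same second difference quotient at nearby points. *)
Lemma derive_sym (V : normedModType R) (U : set V) (f : V -> R) (x v w : V) :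
  open U -> class_C 2 U f -> U x -> 'D_w ('D_v f) x = 'D_v ('D_w f) x.
Proof.
move=> oU cf Ux; have [_ dvf] := cf.
have cont u1 u2 : {for x, continuous ('D_u2 ('D_u1 f))}.
  by have [_ /(_ u2)] := dvf u1; apply.
apply/eqP; rewrite -subr_eq0 -normr_le0; apply/ler_addgt0Pl => e e0.
rewrite addr0.
have e2 : 0 < e / 2 by rewrite divr_gt0.
have /nbhs_ballP[d /= d0 dU] : nbhs x U by exact: open_nbhs_nbhs.
have /cvgrPdist_le/(_ _ e2)/nbhs_ballP[d1 /= d10 H1] := cont v w.
have /cvgrPdist_le/(_ _ e2)/nbhs_ballP[d2 /= d20 H2] := cont w v.
pose r := Num.min d (Num.min d1 d2).
have r0 : 0 < r by rewrite !lt_min d0 d10 d20.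
have N0 : 0 < `|v| + `|w| + 1 by rewrite ltr_pwDr// addr_ge0.
pose s := r / (`|v| + `|w| + 1).
have s0 : 0 < s by rewrite divr_gt0.
have near_x (a b : R) : 0 <= a <= s -> 0 <= b <= s ->
    `|x - (x + a *: v + b *: w)| < r.
  move=> /andP[a0 as_] /andP[b0 bs]; rewrite -addrA opprD addNKr normrN.
  rewrite (le_lt_trans (ler_normD _ _))// !normrZ !ger0_norm//.
  apply: (@le_lt_trans _ _ (s * (`|v| + `|w|))).
    by rewrite mulrDr lerD// ler_wpM2r.
  by rewrite /s mulrAC ltr_pdivrMr// ltr_pM2l// ltrDl.
have sub (a b : R) : 0 <= a <= s -> 0 <= b <= s ->
   [/\ ball x d (x + a *: v + b *: w), ball x d1 (x + a *: v + b *: w)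
     & ball x d2 (x + a *: v + b *: w)].
  move=> /near_x/[apply]; rewrite -ball_normE/= !lt_min.
  by move=> /andP[-> /andP[-> ->]].
have [|a [b [as_ bs E1]]] := second_difference cf s0 (x := x) (v := v) (w := w).
  by move=> a b /sub/[apply] -[/dU].
have [|a' [b' [as' bs' E2]]] :=
    second_difference cf s0 (x := x) (v := w) (w := v).
  by move=> a' b' as' bs'; rewrite addrAC; have [/dU] := sub _ _ bs' as'.
have {}E2 : s * s * 'D_w ('D_v f) (x + a *: v + b *: w) =
    s * s * 'D_v ('D_w f) (x + b' *: v + a' *: w).
  rewrite [x + b' *: v + a' *: w]addrAC.
  apply: etrans (esym E1) (etrans _ E2).
  by rewrite [x + s *: w + s *: v]addrAC; ring.
have ss0 : s * s != 0 by rewrite mulf_neq0 ?gt_eqF.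
move/(mulfI ss0) in E2.
have [_ /H1 + _] := sub _ _ as_ bs; have [_ _ /H2] := sub _ _ bs' as'.
rewrite E2; rewrite /= => B1 A1.
have key (A B C : R) : `|A - C| <= e / 2 -> `|B - C| <= e / 2 -> `|A - B| <= e.
  move=> A1' B1'; apply: le_trans (ler_distD C A B) _.
  rewrite distrC in B1'; apply: le_trans (lerD A1' B1') _.
  by rewrite -splitr.
exact: key A1 B1.
Qed.

Lemma derive_sym_mx (V : normedModType R) (U : set V) m n
    (f : V -> 'M[R]_(m, n)) (x v w : V) :
  open U -> class_C 2 U f -> U x -> 'D_w ('D_v f) x = 'D_v ('D_w f) x.
Proof.
move=> oU cf Ux; apply/matrixP => i j.
have cfij : class_C 2 U (fun y => f y i j) by apply/(class_C_mxP _ _ oU): i j.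
have E u1 u2 : ('D_u2 ('D_u1 f) x) i j = 'D_u2 ('D_u1 (fun y => f y i j)) x.
  rewrite derive_mx_coord; last exact: (cf.2 u1).1.
  apply: near_eq_derive; near=> y; rewrite derive_mx_coord//.
  by apply: cf.1; near: y; exact: open_nbhs_nbhs.
by apply: etrans (E v w) _; apply: etrans (esym (E w v)); exact: derive_sym oU cfij Ux.
Unshelve. all: by end_near. Qed.

End MeanValue.

(** * Uniform bounds on balls *)

Section Bounds.
Context {R : realType} {n : nat}.
Variables (U : set 'rV[R]_n) (x0 : 'rV[R]_n) (r : R).
Hypothesis r0 : 0 < r.
Hypothesis sU : forall y, `|x0 - y| <= r -> U y.

Lemma ball_segment x y (t : R) : `|x0 - x| <= r -> `|x0 - (x + y)| <= r ->
  0 <= t <= 1 -> `|x0 - (x + t *: y)| <= r.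
Proof.
move=> xr yr /andP[t0 t1].
have -> : x0 - (x + t *: y) = (1 - t) *: (x0 - x) + t *: (x0 - (x + y)).
  by apply/rowP => i; rewrite !mxE; ring.
rewrite (le_trans (ler_normD _ _))// !normrZ !ger0_norm ?subr_ge0//.
have -> : r = (1 - t) * r + t * r by ring.
by rewrite lerD// ler_wpM2l// subr_ge0.
Qed.

Lemma bounded_on_ball (W : normedModType R) (f : 'rV[R]_n -> W) :
  class_C 0 U f ->
  exists2 C, 0 <= C & forall y, `|x0 - y| <= r -> `|f y| <= C.
Proof.
move=> cf.
have KE : closed_ball x0 r = [set y | `|x0 - y| <= r] by rewrite closed_ballE.
have Kc : compact (closed_ball x0 r).
  apply: bounded_closed_compact; last exact: closed_ball_closed.
  exists (`|x0| + r); split; first by rewrite num_real.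
  move=> M ltM y; rewrite KE/= => yr; apply/ltW/le_lt_trans/ltM.
  rewrite -[y](subKr x0) (le_trans (ler_normB _ _))//.
  by rewrite lerD2l.
have K0 : closed_ball x0 r !=set0 by exists x0; rewrite KE/= subrr normr0 ltW.
have cK : {within closed_ball x0 r, continuous (fun y => `|f y| : R)}.
  apply: continuous_in_subspaceT => y; rewrite inE KE/= => yr.
  by apply: continuous_comp; [exact/cf/sU|exact: norm_continuous].
have [c _ cM] := EVT_max_rV K0 Kc cK.
by exists `|f c| => // y yr; apply: cM; rewrite inE KE.
Qed.

Lemma derive_bound (W : normedModType R) (f : 'rV[R]_n -> W) :
  class_C 1 U f ->
  exists2 C, 0 <= C & forall y v, `|x0 - y| <= r -> `|'D_v f y| <= C * `|v|.
Proof.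
move=> [df dvf].
have /choice[C HC] (j : 'I_n) : exists c : R, 0 <= c /\
    forall y, `|x0 - y| <= r -> `|'D_(delta_mx 0 j) f y| <= c.
  by have [c c0 Hc] := bounded_on_ball (dvf (delta_mx 0 j)); exists c.
exists (\sum_j C j) => [|y v yr]; first by apply: sumr_ge0 => j _; exact: (HC j).1.
rewrite derive_row; last exact/df/sU.
rewrite (le_trans (ler_norm_sum _ _ _))// mulr_suml.
apply: ler_sum => j _; rewrite normrZ mulrC.
by apply: ler_pM => //; [exact: (HC j).2|exact: ler_mx_coord].
Qed.

(** The mean value theorem applies to each entry; the ball is convex, so the
    intermediate point stays where the derivative is bounded. *)
Lemma lipschitz_on_ball p q (f : 'rV[R]_n -> 'M[R]_(p, q)) :
  open U -> class_C 1 U f ->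
  exists2 C, 0 <= C & forall y v, `|x0 - y| <= r -> `|x0 - (y + v)| <= r ->
    `|f (y + v) - f y| <= C * `|v|.
Proof.
move=> oU cf; have [C C0 HC] := derive_bound cf; exists C => // y v yr vr.
apply: mx_norm_le => [|i j]; first exact: mulr_ge0.
have seg (t : R) : 0 <= t <= 1 -> `|x0 - (y + t *: v)| <= r.
  exact: ball_segment.
have [t t01|t /seg tr E] := @MVT_line R _ (fun y => f y i j) y v.
  have /class_C_mxP-/(_ oU i j) cfij := cf.
  by apply: cfij.1; exact/sU/seg.
rewrite !mxE E -derive_mx_coord; last exact/cf.1/sU.
exact: le_trans (ler_mx_coord _ _ _) (HC _ _ tr).
Qed.

(** The mean value theorem turns the remainder into an increment of D_v f, which
    is at most C |v|^2 because the partial derivatives are Lipschitz. *)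
Lemma taylor_on_ball p q (f : 'rV[R]_n -> 'M[R]_(p, q)) :
  open U -> class_C 2 U f ->
  exists2 C, 0 <= C & forall y v, `|x0 - y| <= r -> `|x0 - (y + v)| <= r ->
    `|f (y + v) - f y - 'D_v f y| <= C * `|v| ^+ 2.
Proof.
move=> oU cf; have cf1 := class_CW cf.
have /choice[C HC] (j : 'I_n) : exists c : R, 0 <= c /\
    forall y v, `|x0 - y| <= r -> `|x0 - (y + v)| <= r ->
    `|'D_(delta_mx 0 j) f (y + v) - 'D_(delta_mx 0 j) f y| <= c * `|v|.
  have [c c0 Hc] := lipschitz_on_ball oU (cf.2 (delta_mx 0 j)).
  by exists c.
exists (\sum_j C j) => [|y v yr vr].
  by apply: sumr_ge0 => j _; exact: (HC j).1.
have dv z : `|x0 - z| <= r ->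
    'D_v f z = \sum_j v 0 j *: 'D_(delta_mx 0 j) f z.
  by move=> zr; rewrite derive_row//; exact/cf1.1/sU.
have seg (t : R) : 0 <= t <= 1 -> `|x0 - (y + t *: v)| <= r.
  exact: ball_segment.
apply: mx_norm_le => [|i j].
  by rewrite mulr_ge0 ?exprn_ge0// sumr_ge0// => j _; exact: (HC j).1.
have [t t01|t t01 E] := @MVT_line R _ (fun y => f y i j) y v.
  have /class_C_mxP-/(_ oU i j) cfij := cf1.
  by apply: cfij.1; exact/sU/seg.
have tr := seg _ t01.
have -> : (f (y + v) - f y - 'D_v f y) i j =
    ('D_v f (y + t *: v) - 'D_v f y) i j.
  have -> : (f (y + v) - f y - 'D_v f y) i j =
    f (y + v) i j - f y i j - ('D_v f y) i j by rewrite !mxE.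
  by rewrite E -derive_mx_coord ?mxE//; exact/cf1.1/sU.
apply: le_trans (ler_mx_coord _ i j) _.
rewrite !dv// -sumrB (le_trans (ler_norm_sum _ _ _))// mulr_suml.
apply: ler_sum => l _; rewrite -scalerBr normrZ expr2 mulrCA.
apply: ler_pM => //; first exact: ler_mx_coord.
apply: le_trans ((HC l).2 _ _ yr tr) _.
rewrite ler_wpM2l ?(HC l).1// normrZ ler_piMl//.
by move/andP: t01 => [t0 t1]; rewrite ger0_norm.
Qed.

End Bounds.

(** * Ordinary differential equations *)

Section Clamp.
Context {R : realType}.
Implicit Types a b s t : R.

(** The 1-Lipschitz retraction of the line onto [a, b]. *)
Definition clamp a b t : R := Num.max a (Num.min t b).

Lemma clamp_itv a b t : a <= b -> a <= clamp a b t <= b.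
Proof. by move=> ab; rewrite /clamp le_max lexx ge_max ab ge_min lexx orbT. Qed.

Lemma clamp_id a b t : a <= t <= b -> clamp a b t = t.
Proof. by move=> /andP[at_ tb]; rewrite /clamp min_l// max_r. Qed.

Lemma clamp_lipschitz a b s t : `|clamp a b s - clamp a b t| <= `|s - t|.
Proof.
wlog st : s t / s <= t.
  move=> H; case: (leP s t) => [/H//|/ltW/H].
  by rewrite distrC [in leRHS]distrC.
rewrite distrC [leRHS]distrC [leRHS]ger0_norm ?subr_ge0//.
rewrite /clamp /Num.max /Num.min; case: (ltP s b) => sb; case: (ltP t b) => tb;
  case: (ltP a s) => as_; case: (ltP a t) => at_; case: (ltP a b) => ab;
  rewrite ler_norml; lra.
Qed.

Lemma lipschitz_continuous (V W : normedModType R) (f : V -> W) (c : R) :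
  (forall x y, `|f x - f y| <= c * `|x - y|) -> continuous f.
Proof.
move=> fL x; apply/cvgrPdist_le => e e0.
have c0 : 0 < `|c| + 1 by rewrite ltr_pwDr.
near=> y; apply: le_trans (fL x y) _.
have h : `|x - y| <= e / (`|c| + 1).
  by near: y; apply: cvgr_dist_le; [exact: cvg_id|exact: divr_gt0].
rewrite ler_pdivlMr// in h; apply: le_trans h; rewrite mulrC ler_wpM2l//.
by rewrite (le_trans (ler_norm c))// lerDl.
Unshelve. all: by end_near. Qed.

Lemma clamp_continuous a b : continuous (clamp a b).
Proof.
apply: (@lipschitz_continuous R R _ 1) => s t.
by rewrite mul1r clamp_lipschitz.
Qed.

End Clamp.

Section Curves.
Context {R : realType} {n : nat}.
Implicit Types z : R -> 'rV[R]_n.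

Lemma curve_bound z (z' : R -> 'rV[R]_n) (c : R) : continuous z -> 0 <= c ->
  (forall t : R, 0 < t < 1 -> is_derive t 1 z (z' t)) ->
  (forall t : R, 0 < t < 1 -> `|z' t| <= c) ->
  forall t : R, 0 <= t <= 1 -> `|z t - z 0| <= c.
Proof.
move=> cz c0 dz z'c t /andP[t0 t1]; apply: mx_norm_le => // i j.
rewrite ord1 {i}.
move: t0; rewrite le_eqVlt => /predU1P[<-|t0].
  by rewrite subrr mxE normr0.
have t_1 (s : R) : s \in `]0, t[ -> 0 < s < 1.
  by rewrite in_itv/= => /andP[-> st]; exact: lt_le_trans st t1.
have [||s /t_1 s1 E] := @MVT R (fun s => z s 0 j) (fun s => z' s 0 j) 0 t t0.
- move=> s /t_1 s1; have [d1 d2] := dz s s1.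
  apply: DeriveDef; first by have /derivable_mxP := d1; exact.
  by rewrite -d2 derive_mx// mxE.
- apply: continuous_subspaceT => s.
  apply: (continuous_comp (g := fun N : 'rV[R]_n => N 0 j)); first exact: cz.
  exact: coord_continuous.
rewrite !mxE E subr0 normrM (gtr0_norm t0) -[leRHS]mulr1.
apply: ler_pM => //; first exact: ltW.
exact: le_trans (ler_mx_coord _ _ _) (z'c s s1).
Qed.

(** As the constant 1/2 is smaller than the inverse of the length of the interval,
    no exponential is needed: the maximal norm m of u over the unit interval
    satisfies m <= m/2 + e. *)
Lemma gronwall_half (u u' : R -> 'rV[R]_n) (e : R) : continuous u -> 0 <= e ->
  u 0 = 0 ->
  (forall t : R, 0 < t < 1 -> is_derive t 1 u (u' t)) ->
  (forall t : R, 0 < t < 1 -> `|u' t| <= 2^-1 * `|u t| + e) ->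
  forall t : R, 0 <= t <= 1 -> `|u t| <= 2 * e.
Proof.
move=> cu e0 u0 du u'e.
have cnu : {within `[0, 1], continuous (fun t => `|u t|)}.
  apply: continuous_subspaceT => t.
  by apply: continuous_comp; [exact: cu|exact: norm_continuous].
have [c c01 cmax] := EVT_max ler01 cnu.
have umax (t : R) : 0 <= t <= 1 -> `|u t| <= `|u c|.
  by move=> t01; apply: cmax; rewrite in_itv.
have m0 : 0 <= 2^-1 * `|u c| + e by rewrite addr_ge0// mulr_ge0.
have : `|u c| <= 2^-1 * `|u c| + e.
  rewrite -[u c in leLHS]subr0 -u0.
  apply: (curve_bound cu m0 du) => [t t01|]; last by move: c01; rewrite in_itv.
  apply: le_trans (u'e t t01) _; rewrite lerD2r ler_wpM2l// umax//.
  by case/andP: t01 => /ltW -> /ltW ->.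
move=> cE t /umax /le_trans; apply; move: cE; move: `|u c| => m; lra.
Qed.

Lemma continuous_row z : (forall j, continuous (fun t => z t 0 j)) ->
  continuous z.
Proof.
move=> cz t; have c0 : class_C 0 setT z.
  by apply/class_C_mxP => [|i j s _]; [exact: openT|rewrite ord1; exact: cz].
exact: c0.
Qed.

(** The primitive is frozen outside the unit interval, so that a bound over
    [0, 1] is a bound over the whole line: iterates can then be compared in the
    uniform norm over R.  The integral starts at -1 to make 0 an interior point,
    where the fundamental theorem of calculus gives a two-sided derivative. *)
Lemma antiderivative (g : R -> R) : continuous g ->
  exists G : R -> R, [/\ continuous G, G 0 = 0,
    forall t : R, 0 < t < 1 -> is_derive t 1 G (g t)
    & forall t, G (clamp 0 1 t) = G t].
Proof.
move=> cg.
pose F (t : R) : R := (\int[lebesgue_measure]_(s in `[(-1), t]) g s)%R.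
have dF (t : R) : -1 < t < 2 -> is_derive t 1 F (g t).
  move=> /andP[t0 t2].
  have gi : lebesgue_measure.-integrable `[(-1), 2] (EFin \o g).
    apply: continuous_compact_integrable; first exact: segment_compact.
    exact: continuous_subspaceT.
  have [|dF dFE] := continuous_FTC1_closed t2 gi t0; first exact: cg.
  by apply: DeriveDef; [exact: dF|rewrite -derive1E; exact: dFE].
pose cl := clamp (0 : R) 1.
have cl01 t : 0 <= cl t <= 1 by exact: clamp_itv.
exists (fun t => F (cl t) - F 0); split.
- move=> t; apply: cvgB; last exact: cvg_cst.
  apply: continuous_comp; first exact: clamp_continuous.
  apply: differentiable_continuous; apply/derivable1_diffP.
  have /andP[c0 c1] := cl01 t.
  have [] // := dF (cl t) _.
  by rewrite (lt_le_trans _ c0)//= (le_lt_trans c1)// ltr1n.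
- by rewrite /cl clamp_id ?lexx ?ler01// subrr.
- move=> t /andP[t0 t1].
  have H : is_derive t 1 (F - cst (F 0)) (g t - 0).
    have dFt : is_derive t 1 F (g t).
      by apply: dF; rewrite (lt_trans _ t0)//= (lt_trans t1)// ltr1n.
    by apply: is_deriveB.
  rewrite subr0 in H; apply: near_eq_is_derive H.
  have t_in : t \in `]0, 1[ by rewrite in_itv/= t0.
  apply: filterS (near_in_itvoo t_in) => s; rewrite in_itv/= => /andP[s0 s1].
  by rewrite /= /cl clamp_id// !ltW.
- by move=> t; rewrite /cl [clamp 0 1 (clamp 0 1 t)]clamp_id.
Qed.

Lemma antiderivative_row (g : R -> 'rV[R]_n) : continuous g ->
  exists G : R -> 'rV[R]_n, [/\ continuous G, G 0 = 0,
    forall t : R, 0 < t < 1 -> is_derive t 1 G (g t)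
    & forall t, G (clamp 0 1 t) = G t].
Proof.
move=> cg.
have /choice[G HG] (j : 'I_n) : exists G : R -> R, [/\ continuous G, G 0 = 0,
    forall t : R, 0 < t < 1 -> is_derive t 1 G (g t 0 j)
    & forall t, G (clamp 0 1 t) = G t].
  apply: antiderivative => t.
  apply: (continuous_comp (g := fun N : 'rV[R]_n => N 0 j)); first exact: cg.
  exact: coord_continuous.
exists (fun t => \row_j G j t); split.
- apply: continuous_row => j; have [cG _ _ _] := HG j.
  by rewrite (_ : (fun _ => _) = G j)//; apply/funext => t; rewrite mxE.
- by apply/rowP => j; rewrite !mxE; have [] := HG j.
- move=> t t01.
  have dE j : (fun s : R => (\row_j G j s) 0 j) = G j.
    by apply/funext => s; rewrite mxE.
  have dG : derivable (fun s : R => \row_j G j s) t 1.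
    apply/derivable_mxP => i j; rewrite ord1 dE.
    by have [_ _ /(_ t t01) [] //] := HG j.
  apply: DeriveDef => //; rewrite derive_mx//; apply/rowP => j.
  by rewrite mxE dE; have [_ _ /(_ t t01) [] //] := HG j.
- by move=> t; apply/rowP => j; rewrite !mxE; have [] := HG j.
Qed.

(** The sequences u_k - 2 A / 2^k and u_k + 2 A / 2^k are monotone and enclose
    the limit, which yields existence and the error bound at once. *)
Lemma geometric_limit (u : nat -> R) (A : R) : 0 <= A ->
  (forall k, `|u k.+1 - u k| <= A * 2^-1 ^+ k) ->
  exists l, forall k, `|u k - l| <= 2 * A * 2^-1 ^+ k.
Proof.
move=> A0 uA; pose a k := u k - 2 * A * 2^-1 ^+ k.
pose b k := u k + 2 * A * 2^-1 ^+ k.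
have qS k : 2 * A * 2^-1 ^+ k.+1 = A * 2^-1 ^+ k :> R.
  by rewrite exprS; field.
have q0 k : 0 <= A * 2^-1 ^+ k by rewrite mulr_ge0// exprn_ge0.
have a_homo : {homo a : k m / (k <= m)%N >-> k <= m}.
  apply: homo_leq => [//|x y z|k]; first exact: le_trans.
  have := uA k; rewrite ler_norml /a qS => /andP[+ _].
  by rewrite -mulrA; lra.
have b_homo : {homo b : k m / (k <= m)%N >-> m <= k}.
  apply: homo_leq => [//|x y z xy yz|k]; first exact: le_trans yz xy.
  have := uA k; rewrite ler_norml /b qS => /andP[_ +].
  by rewrite -mulrA; lra.
have ab k m : a k <= b m.
  apply: le_trans (a_homo _ _ (leq_maxl k m)) _.
  apply: le_trans (b_homo _ _ (leq_maxr k m)).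
  by rewrite /a /b -mulrA; have := q0 (maxn k m); lra.
have ub k : ubound (range a) (b k) by move=> _ [m _ <-]; exact: ab.
have rne : range a !=set0 by exists (a 0%N), 0%N.
exists (sup (range a)) => k; rewrite ler_norml.
have l1 : a k <= sup (range a).
  by apply: ub_le_sup; [exists (b 0%N); exact: ub|exists k].
have l2 : sup (range a) <= b k by apply: ge_sup; [exact: rne|exact: ub].
by move: l1 l2; rewrite /a /b; lra.
Qed.

(** Picard iteration over the unit interval.  The Lipschitz constant 1/2 makes
    the integral operator a contraction for the uniform norm. *)
Theorem picard (F : 'rV[R]_n -> 'rV[R]_n) (x0 : 'rV[R]_n) :
  (forall x y, `|F x - F y| <= 2^-1 * `|x - y|) ->
  exists z : R -> 'rV[R]_n, [/\ continuous z, z 0 = x0 &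
    forall t : R, 0 < t < 1 -> is_derive t 1 z (F (z t))].
Proof.
move=> FL.
have cF : continuous F by exact: lipschitz_continuous FL.
have /choice[T HT] (z : {z : R -> 'rV[R]_n | continuous z}) :
    exists w : {z : R -> 'rV[R]_n | continuous z}, [/\ sval w 0 = x0,
      forall t : R, 0 < t < 1 -> is_derive t 1 (sval w) (F (sval z t))
      & forall t, sval w (clamp 0 1 t) = sval w t].
  case: z => z cz /=.
  have [|G [cG G0 dG clG]] := @antiderivative_row (F \o z).
    by move=> t; apply: continuous_comp; [exact: cz|exact: cF].
  have cG' : continuous (fun t => x0 + G t).
    by move=> t; apply: cvgD; [exact: cvg_cst|exact: cG].
  exists (exist _ _ cG'); split=> /= [|t t01|t].
  - by rewrite G0 addr0.
  - have H : is_derive t 1 (cst x0 + G) (0 + F (z t)).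
      by have dGt := dG t t01; apply: is_deriveD.
    by rewrite add0r in H.
  - by rewrite clG.
have TL (z w : {z : R -> 'rV[R]_n | continuous z}) m : 0 <= m ->
    (forall t, `|sval z t - sval w t| <= m) ->
    forall t, `|sval (T z) t - sval (T w) t| <= 2^-1 * m.
  move=> m0 zw t; have [Tz0 dTz clTz] := HT z; have [Tw0 dTw clTw] := HT w.
  rewrite -clTz -clTw; set s := clamp 0 1 t.
  have -> : sval (T z) s - sval (T w) s =
      (sval (T z) s - sval (T w) s) - (sval (T z) 0 - sval (T w) 0).
    by rewrite Tz0 Tw0 subrr subr0.
  apply: (@curve_bound (sval (T z) - sval (T w))
      (fun t => F (sval z t) - F (sval w t))).
  - move=> s'; apply: cvgB; [exact: (svalP (T z))|exact: (svalP (T w))].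
  - by rewrite mulr_ge0.
  - by move=> s' s'01; have d1 := dTz _ s'01; have d2 := dTw _ s'01;
      apply: is_deriveB.
  - move=> s' _; apply: le_trans (FL _ _) _.
    by rewrite ler_wpM2l.
  - exact: clamp_itv.
have c0 : continuous (fun _ : R => x0) by move=> t; exact: cvg_cst.
pose zs k := iter k T (exist _ _ c0).
pose A := `|F x0|.
have A0 : 0 <= A by exact: normr_ge0.
have q0 k : 0 <= (2^-1 : R) ^+ k by rewrite exprn_ge0// invr_ge0.
have Aq0 k : 0 <= A * 2^-1 ^+ k by exact: mulr_ge0.
have A2q0 k : 0 <= 2 * A * 2^-1 ^+ k by apply: mulr_ge0 => //; exact: mulr_ge0.
have zsA k : forall t, `|sval (zs k.+1) t - sval (zs k) t| <= A * 2^-1 ^+ k.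
  elim: k => [|k IH] t; last first.
    rewrite exprS mulrCA; exact: TL (Aq0 k) IH t.
  rewrite expr0 mulr1 /=.
  have [T0 dT clT] := HT (exist _ _ c0).
  rewrite -clT -[X in _ - X]T0.
  apply: (@curve_bound _ (fun=> F x0)) => //.
  - exact: (svalP (T _)).
  - exact: clamp_itv.
have /choice[z Hz] (t : R) : exists l : 'rV[R]_n,
    forall k, `|sval (zs k) t - l| <= 2 * A * 2^-1 ^+ k.
  have /choice[l Hl] (j : 'I_n) : exists l : R,
      forall k, `|sval (zs k) t 0 j - l| <= 2 * A * 2^-1 ^+ k.
    apply: geometric_limit => // k; apply: le_trans (zsA k t).
    by apply: le_trans (ler_mx_coord _ 0 j); rewrite !mxE.
  exists (\row_j l j) => k; apply: mx_norm_le => [|i j]; first exact: A2q0.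
  by rewrite !mxE ord1.
have q_small (e : R) : 0 < e -> exists k, 2 * A * 2^-1 ^+ k <= e.
  move=> e0.
  have /cvgrPdist_le/(_ _ e0)[k _ /(_ k (leqnn k))] :
      geometric (2 * A) (2^-1 : R) k @[k --> \oo] --> (0 : R).
    by apply: cvg_geometric; rewrite ger0_norm// invf_lt1// ltr1n.
  by rewrite /= sub0r normrN ger0_norm; [exists k|exact: A2q0].
have cz : continuous z.
  move=> t; apply/cvgrPdist_le => e e0.
  have e3 : 0 < e / 3 by rewrite divr_gt0.
  have [k ke] := q_small _ e3.
  near=> s.
  have -> : z t - z s = (z t - sval (zs k) t) +
      ((sval (zs k) t - sval (zs k) s) + (sval (zs k) s - z s)).
    by rewrite !addrA !subrK.
  have h1 := le_trans (Hz t k) ke; have h2 := le_trans (Hz s k) ke.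
  have h3 : `|sval (zs k) t - sval (zs k) s| <= e / 3.
    by near: s; apply: cvgr_dist_le => //; exact: (svalP (zs k)).
  rewrite (le_trans (ler_normD _ _))// [X in X + _]distrC.
  have := ler_normD (sval (zs k) t - sval (zs k) s) (sval (zs k) s - z s).
  lra.
pose zc : {z : R -> 'rV[R]_n | continuous z} := exist _ z cz.
have fixz t : sval (T zc) t = z t.
  apply/eqP; rewrite -subr_eq0 -normr_le0; apply/ler_addgt0Pl => e e0.
  rewrite addr0; have [k ke] := q_small _ e0.
  have h1 : `|sval (T zc) t - sval (zs k.+1) t| <= 2^-1 * (2 * A * 2^-1 ^+ k).
    apply: TL => [|s]; first exact: A2q0.
    by rewrite distrC.
  have h2 := Hz t k.+1.
  apply: le_trans (ler_distD (sval (zs k.+1) t) _ _) _.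
  move: h1 h2; rewrite exprS; lra.
have [T0 dT _] := HT zc.
have E : sval (T zc) = z by apply/funext.
exists z; split; [exact: cz|by rewrite -E|].
by move=> t /dT; rewrite E.
Unshelve. all: by end_near. Qed.

End Curves.

(** * Integration of commuting frames *)

(** The terms left over when the approximate solution of [flow_map] is inserted
    in the equation: A is a derivative of E along a vector of length s = O(|h|),
    and rho a second-order Taylor remainder of E. *)
Lemma defect_bound (R : realType) (n k : nat) (h g : 'rV[R]_k)
    (A rho : 'M[R]_(k, n)) (D1 C2 c d s : R) : `|g| <= d ->
  0 <= D1 -> 0 <= C2 -> 0 <= c -> 0 <= s -> s <= `|h| * c ->
  `|A| <= D1 * s -> `|rho| <= C2 * s ^+ 2 ->
  `|h *m A + g *m rho| <=
    (k%:R * (D1 * c) + k%:R * (d * (C2 * c ^+ 2))) * `|h| ^+ 2.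
Proof.
move=> gd D10 C20 c0 s0 sh Ab rb.
have hc0 : 0 <= `|h| * c by exact: mulr_ge0.
apply: le_trans (ler_normD _ _) _; rewrite mulrDl; apply: lerD.
  apply: le_trans (norm_mulmx_le _ _) _; rewrite -mulrA ler_wpM2l//.
  have -> : D1 * c * `|h| ^+ 2 = `|h| * (D1 * (`|h| * c)) by ring.
  by rewrite ler_wpM2l//; apply: le_trans Ab _; rewrite ler_wpM2l.
apply: le_trans (norm_mulmx_le _ _) _; rewrite -mulrA ler_wpM2l//.
have -> : d * (C2 * c ^+ 2) * `|h| ^+ 2 = d * (C2 * (`|h| * c) ^+ 2) by ring.
apply: ler_pM => //; apply: le_trans rb _.
by rewrite ler_wpM2l// lerXn2r.
Qed.

Section Flow.
Context {R : realType} {n k : nat}.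
Variables (W : set 'rV[R]_n) (E : 'rV[R]_n -> 'M[R]_(k, n)).
Variables (x0 : 'rV[R]_n) (r : R).
Hypotheses (oW : open W) (r0 : 0 < r).
Hypothesis sW : forall y, `|x0 - y| <= r -> W y.
Hypothesis sE : smooth_on W E.

(** Composing E with the retraction onto the ball around x0 (a cube, for the
    maximum norm) makes the right-hand side of z' = u E(z) globally Lipschitz
    without changing it near x0. *)
Definition clamp_ball (y : 'rV[R]_n) : 'rV[R]_n :=
  \row_j clamp (x0 0 j - r) (x0 0 j + r) (y 0 j).

Lemma clamp_ball_in y : `|x0 - clamp_ball y| <= r.
Proof.
apply: mx_norm_le => [|i j]; first exact: ltW.
have /(@clamp_itv _ _ _ (y 0 j)) : x0 0 j - r <= x0 0 j + r.
  by have := r0; lra.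
by rewrite !mxE ord1 ler_norml; lra.
Qed.

Lemma clamp_ball_id y : `|x0 - y| <= r -> clamp_ball y = y.
Proof.
move=> yr; apply/rowP => j; rewrite mxE clamp_id//.
have := le_trans (ler_mx_coord (x0 - y) 0 j) yr.
by rewrite !mxE ler_norml; lra.
Qed.

Lemma clamp_ball_lipschitz x y : `|clamp_ball x - clamp_ball y| <= `|x - y|.
Proof.
apply: mx_norm_le => // i j; rewrite !mxE.
apply: le_trans (clamp_lipschitz _ _ _ _) _.
by apply: le_trans (ler_mx_coord _ 0 j); rewrite !mxE.
Qed.

(** For small u the curve z with z' = u E(z) and z(0) = x0 exists over the whole
    unit interval and stays well inside the ball where E is controlled. *)
Lemma flow_exists : exists d c : R, [/\ 0 < d, 0 <= c, d * c <= r / 2 & [/\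
  forall (h : 'rV[R]_k) y, `|x0 - y| <= r -> `|h *m E y| <= `|h| * c,
  forall (h : 'rV[R]_k) x y, `|h| <= d -> `|x0 - x| <= r -> `|x0 - y| <= r ->
    `|h *m E x - h *m E y| <= 2^-1 * `|x - y|
  & forall u : 'rV[R]_k, `|u| <= d -> exists z : R -> 'rV[R]_n,
    [/\ continuous z, z 0 = x0,
      forall t : R, 0 <= t <= 1 -> `|z t - x0| <= `|u| * c
    & forall t : R, 0 < t < 1 -> is_derive t 1 z (u *m E (z t))]]].
Proof.
have [C0 C00 HC0] := bounded_on_ball r0 sW (sE 0%N).
have [C1 C10 HC1] := lipschitz_on_ball r0 sW oW (sE 1%N).
pose c := k%:R * C0; pose c1 := k%:R * C1.
have c0 : 0 <= c by exact: mulr_ge0.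
have c10 : 0 <= c1 by exact: mulr_ge0.
(* The radius d makes d c1 <= 1/2, the contraction constant of Picard iteration,
   and d c <= r/2, which keeps the curves in the half ball. *)
pose N := 2 * (c + c1) + 1.
have N0 : 0 < N by rewrite /N; lra.
pose d := Num.min 1 r / N.
have d0 : 0 < d by rewrite divr_gt0// lt_min ltr01.
have dN1 : d * N <= 1 by rewrite divfK ?gt_eqF// ge_min lexx.
have dNr : d * N <= r by rewrite divfK ?gt_eqF// ge_min lexx orbT.
have dc : d * c <= r / 2.
  have : 0 <= d * c1 by rewrite mulr_ge0// ltW.
  by have := dNr; have := ltW d0; rewrite /N; lra.
have dc1 : d * c1 <= 2^-1.
  have : 0 <= d * c by rewrite mulr_ge0// ltW.
  by have := dN1; have := ltW d0; rewrite /N; lra.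
have Ec (h : 'rV[R]_k) y : `|x0 - y| <= r -> `|h *m E y| <= `|h| * c.
  move=> yr; apply: le_trans (norm_mulmx_le _ _) _.
  by rewrite /c mulrCA !ler_wpM2l// HC0.
have EL (h : 'rV[R]_k) x y : `|h| <= d -> `|x0 - x| <= r -> `|x0 - y| <= r ->
    `|h *m E x - h *m E y| <= 2^-1 * `|x - y|.
  move=> hd xr yr; rewrite -mulmxBr; apply: le_trans (norm_mulmx_le _ _) _.
  have HL : `|E x - E y| <= C1 * `|x - y|.
    by have := HC1 y (x - y) yr; rewrite [y + _]addrC subrK; apply.
  apply: (@le_trans _ _ (d * c1 * `|x - y|)); last by rewrite ler_wpM2r.
  have -> : d * c1 * `|x - y| = k%:R * (d * (C1 * `|x - y|)).
    by rewrite /c1; ring.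
  by rewrite ler_wpM2l// ler_pM.
exists d, c; split => //; split => // u ud.
have FL x y : `|u *m E (clamp_ball x) - u *m E (clamp_ball y)| <=
    2^-1 * `|x - y|.
  apply: le_trans (EL u _ _ ud (clamp_ball_in x) (clamp_ball_in y)) _.
  by rewrite ler_wpM2l// clamp_ball_lipschitz.
have [z [cz z0 dz]] := picard x0 FL.
have uc0 : 0 <= `|u| * c by exact: mulr_ge0.
have zB (t : R) : 0 <= t <= 1 -> `|z t - x0| <= `|u| * c.
  rewrite -[in X in _ -> X]z0; apply: (curve_bound cz _ dz) => // s _.
  exact/Ec/clamp_ball_in.
exists z; split=> // t t01; have := dz t t01; rewrite clamp_ball_id//.
have t01' : 0 <= t <= 1 by case/andP: t01 => /ltW -> /ltW ->.
rewrite distrC (le_trans (zB t t01'))//.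
apply: le_trans (ler_wpM2r c0 ud) _; apply: le_trans dc _.
by have := r0; lra.
Qed.

Variable pi : 'M[R]_(n, k).
Hypothesis Epi : forall x, W x -> E x *m pi = 1%:M.
Hypothesis Ecomm : forall x (u h : 'rV[R]_k), W x ->
  h *m 'D_(u *m E x) E x = u *m 'D_(h *m E x) E x.

(** The time-one map sigma of the flows from x0.  If z is the curve for u, then
    w(t) = z(t) + t h E(z(t)) satisfies the equation of u + h up to O(|h|^2):
    the first-order terms agree because the rows of E commute.  The curve of
    u + h is then within O(|h|^2) of w, hence the derivative of sigma at u is
    h |-> h E(sigma u). *)
Lemma flow_map : exists (d : R) (sigma : 'rV[R]_k -> 'rV[R]_n),
  [/\ 0 < d, sigma 0 = x0 & forall u, `|u| < d ->
    [/\ W (sigma u), differentiable sigma u,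
      forall h, 'D_h sigma u = h *m E (sigma u)
    & sigma u *m pi = x0 *m pi + u]].
Proof.
have [d [c [d0 c0 dc [Ec EL flows]]]] := flow_exists.
have /choice[z Hz] (u : 'rV[R]_k) : exists z : R -> 'rV[R]_n, `|u| <= d ->
   [/\ continuous z, z 0 = x0,
      forall t : R, 0 <= t <= 1 -> `|z t - x0| <= `|u| * c
    & forall t : R, 0 < t < 1 -> is_derive t 1 z (u *m E (z t))].
  case: (leP `|u| d) => [/flows[z Pz]|_]; first by exists z.
  by exists (fun=> x0).
have oo_cc (t : R) : 0 < t < 1 -> 0 <= t <= 1.
  by move=> /andP[/ltW -> /ltW ->].
have hc (h : 'rV[R]_k) : `|h| <= d -> `|h| * c <= r / 2.
  by move=> hd; apply: le_trans dc; rewrite ler_wpM2r.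
have zr2 u (t : R) : `|u| <= d -> 0 <= t <= 1 -> `|x0 - z u t| <= r / 2.
  move=> ud t01; have [_ _ /(_ t t01) zB _] := Hz u ud.
  by rewrite distrC (le_trans zB)// hc.
have zr u (t : R) : `|u| <= d -> 0 <= t <= 1 -> `|x0 - z u t| <= r.
  by move=> ud t01; apply: le_trans (zr2 u t ud t01) _; have := r0; lra.
have one01 : (0 : R) <= (1 : R) <= (1 : R) by rewrite ler01 lexx.
have zdiff u (t : R) : `|u| <= d -> 0 < t < 1 -> differentiable (z u) t.
  move=> ud t01; apply/derivable1_diffP.
  by have [_ _ _ /(_ t t01) []] := Hz u ud.
pose sigma u := z u 1.
have [D1 D10 HD1] := derive_bound r0 sW (sE 1%N).
have [C2 C20 HC2] := taylor_on_ball r0 sW oW (sE 2%N).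
have diffE (y : 'rV[R]_n) : `|x0 - y| <= r -> differentiable E y.
  by move=> yr; apply: (sE 1%N).1; exact: sW.
pose C := k%:R * (D1 * c) + k%:R * (d * (C2 * c ^+ 2)).
have C0 : 0 <= C.
  by rewrite addr_ge0// !mulr_ge0 ?exprn_ge0// ltW.
have approx (u h : 'rV[R]_k) : `|u| <= d -> `|h| <= d -> `|u + h| <= d ->
    `|sigma (u + h) - sigma u - h *m E (sigma u)| <= 2 * (C * `|h| ^+ 2).
  move=> ud hd uhd; have [cz z0 _ dz] := Hz u ud.
  have [cz2 z20 _ dz2] := Hz _ uhd.
  (* The clamp makes w continuous on the whole line; on the unit interval it
     acts as the identity. *)
  pose w (t : R) := z u t + (0 + t *: h) *m E (clamp_ball (z u t)).
  pose w' (t : R) := u *m E (z u t) +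
    (h *m E (z u t) + (t *: h) *m 'D_(u *m E (z u t)) E (z u t)).
  have wE (t : R) : 0 <= t <= 1 -> w t = z u t + (t *: h) *m E (z u t).
    by move=> t01; rewrite /w add0r clamp_ball_id// zr.
  have dw (t : R) : 0 < t < 1 -> is_derive t 1 w (w' t).
    move=> t01; have zd := zdiff u t ud t01; have dzE := dz t t01.
    have Ed := diffE _ (zr u t ud (oo_cc t t01)).
    have ld := differentiable_line 0 h t.
    have Ezd : differentiable (E \o z u) t by exact: differentiable_comp.
    have md := differentiable_mulmx ld Ezd.
    have H : is_derive t 1
        (fun s : R => z u s + (0 + s *: h) *m (E \o z u) s) (w' t).
      apply: DeriveDef; first exact/diff_derivable/differentiableD.
      rewrite deriveD; [|exact: diff_derivable|exact: diff_derivable].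
      rewrite (derive_mulmx _ ld Ezd) derive_line (derive_comp _ zd Ed).
      by rewrite (@derive_val _ _ _ _ _ _ _ dzE) add0r.
    apply: near_eq_is_derive H.
    have t_in : t \in `]0, 1[ by rewrite in_itv.
    apply: filterS (near_in_itvoo t_in) => s; rewrite in_itv/= => s01.
    by rewrite wE ?add0r//; exact: oo_cc.
  have cw : continuous w.
    have cw0 : class_C 0 setT w; last by move=> t; exact: cw0.
    have cz' : class_C 0 setT (z u) by move=> t _; exact: cz.
    apply: class_C_addmx; [exact: openT|exact: cz'|].
    apply: class_C_mulmx; [exact: openT| |].
      by move=> t _; apply/differentiable_continuous/differentiable_line.
    have ccl : continuous clamp_ball.
      apply: (@lipschitz_continuous R _ _ _ 1) => x y.
      by rewrite mul1r clamp_ball_lipschitz.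
    move=> t _.
    apply: (@continuous_comp _ _ _ (z u) (E \o clamp_ball)); first exact: cz.
    apply: (@continuous_comp _ _ _ clamp_ball E); first exact: ccl.
    exact: (sE 0%N _ (sW (clamp_ball_in (z u t)))).
  have vc (t : R) : 0 <= t <= 1 -> `|(t *: h) *m E (z u t)| <= `|h| * c.
    move=> t01; apply: le_trans (Ec _ _ (zr u t ud t01)) _.
    rewrite ler_wpM2r// normrZ ler_piMl//.
    by case/andP: t01 => t0 t1; rewrite ger0_norm.
  have wr (t : R) : 0 <= t <= 1 -> `|x0 - w t| <= r.
    move=> t01; rewrite wE// opprD addrA (le_trans (ler_normB _ _))//.
    have h1 := zr2 u t ud t01; have h2 := vc t t01; have h3 := hc h hd.
    lra.
  have w'E (t : R) : 0 < t < 1 ->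
      `|(u + h) *m E (w t) - w' t| <= C * `|h| ^+ 2.
    move=> /oo_cc t01; have yr := zr u t ud t01.
    have := wr t t01; have := vc t t01; rewrite wE// /w'.
    have := Ecomm u (t *: h) (sW yr).
    set y := z u t; set v := (t *: h) *m E y => vcomm vh vr.
    set rho := E (y + v) - E y - 'D_v E y.
    have -> : (u + h) *m E (y + v) -
        (u *m E y + (h *m E y + (t *: h) *m 'D_(u *m E y) E y)) =
        h *m 'D_v E y + (u + h) *m rho.
      rewrite vcomm /rho !mulmxBr !mulmxDl.
      move: (u *m E y) (h *m E y) (u *m _) (h *m _) (u *m _) (h *m _).
      by move=> a1 a2 a3 a4 a5 a6; apply/rowP => i; rewrite !mxE; ring.
    have h1 := HD1 y v yr; have h2 := HC2 y v yr vr.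
    exact: defect_bound uhd D10 C20 c0 (normr_ge0 v) vh h1 h2.
  have -> : sigma (u + h) - sigma u - h *m E (sigma u) = z (u + h) 1 - w 1.
    by rewrite wE// scale1r opprD addrA.
  apply: (@gronwall_half _ _ (fun t => z (u + h) t - w t)
    (fun t => (u + h) *m E (z (u + h) t) - w' t)) one01.
  - by move=> t; apply: cvgB; [exact: cz2|exact: cw].
  - by rewrite mulr_ge0// exprn_ge0.
  - rewrite wE ?lexx ?ler01//.
    by rewrite scale0r mul0mx addr0 z20 z0 subrr.
  - by move=> t t01; have d1 := dz2 t t01; have d2 := dw t t01; apply: is_deriveB.
  - move=> t t01; have t01' := oo_cc t t01.
    have h1 := EL _ _ _ uhd (zr _ t uhd t01') (wr t t01').
    apply: le_trans (ler_distD ((u + h) *m E (w t)) _ _) _.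
    by apply: lerD; [exact: h1|exact: w'E].
exists d, sigma; split => // [|u ud].
  have z00 : `|(0 : 'rV[R]_k)| <= d by rewrite normr0 ltW.
  have [_ _ /(_ 1 one01) + _] := Hz 0 z00.
  by rewrite normr0 mul0r normr_le0 subr_eq0 => /eqP.
have ud' := ltW ud; have [cz z0 _ dz] := Hz u ud'.
have cL : continuous (mulmxr (E (sigma u)) : 'rV[R]_k -> 'rV[R]_n).
  by move=> h; apply: differentiable_continuous; exact: differentiable_mulmxr.
have [|ds dsE] := @differentiable_linear_approx _ _ _ sigma u _ cL.
  move=> e e0.
  have K0 : 0 < 2 * C + 1 by lra.
  have m0 : 0 < Num.min (d - `|u|) (e / (2 * C + 1)).
    by rewrite lt_min subr_gt0 ud divr_gt0.
  apply: filterS (nbhs0_lt m0) => h.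
  rewrite lt_min ltrBrDr ltr_pdivlMr// => /andP[h1 h2].
  have uh : `|u + h| <= d.
    by rewrite (le_trans (ler_normD _ _))// addrC ltW.
  have hd : `|h| <= d by have := normr_ge0 u; lra.
  rewrite [h + u]addrC; apply: le_trans (approx u h ud' hd uh) _.
  rewrite expr2 !mulrA ler_wpM2r// mulrC; have := normr_ge0 h; lra.
split => //; first exact/sW/zr.
  by move=> h; rewrite deriveE// dsE.
(* E pi = 1 makes z(t) pi - t u constant. *)
pose p (t : R) := z u t *m pi - (0 + t *: u).
have dp (t : R) : 0 < t < 1 -> is_derive t 1 p 0.
  move=> t01; have zd := zdiff u t ud' t01; have dzE := dz t t01.
  have pd : differentiable (fun=> pi : 'M[R]_(n, k)) t.
    exact: differentiable_cst.
  have md := differentiable_mulmx zd pd; have ld := differentiable_line 0 u t.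
  apply: DeriveDef; first exact/diff_derivable/differentiableB.
  rewrite deriveB; [|exact: diff_derivable|exact: diff_derivable].
  rewrite (derive_mulmx _ zd pd) derive_line derive_cst mulmx0 addr0.
  rewrite (@derive_val _ _ _ _ _ _ _ dzE).
  by rewrite -mulmxA Epi ?mulmx1 ?subrr//; exact/sW/zr/oo_cc.
have cp : continuous p.
  have cp0 : class_C 0 setT p; last by move=> t; exact: cp0.
  apply: class_C_addmx; first exact: openT.
    apply: class_C_mulmx; [exact: openT|by move=> t _; exact: cz|].
    exact: class_C_cst.
  move=> t _; apply: differentiable_continuous; apply: differentiableN.
  exact: differentiable_line.
have p10 : p 1 = p 0.
  apply/eqP; rewrite -subr_eq0 -normr_le0.
  by apply: (curve_bound cp (lexx 0) dp) => // t _; rewrite normr0.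
move: p10; rewrite /p z0 scale1r scale0r !add0r subr0 => <-.
by rewrite subrK.
Qed.

End Flow.

(** Bootstrapping: a solution of D_h sigma = h E(sigma) gains one order of
    differentiability at each step. *)
Lemma smooth_of_derive (R : realType) (n k : nat) (U : set 'rV[R]_k)
    (W : set 'rV[R]_n) (E : 'rV[R]_n -> 'M[R]_(k, n))
    (sigma : 'rV[R]_k -> 'rV[R]_n) : open U -> open W -> smooth_on W E ->
  (forall u, U u -> W (sigma u)) ->
  (forall u, U u -> differentiable sigma u) ->
  (forall u h, U u -> 'D_h sigma u = h *m E (sigma u)) -> smooth_on U sigma.
Proof.
move=> oU oW sE sW ds dsE; elim=> [|l IH].
  by move=> u Uu; exact: differentiable_continuous (ds u Uu).
split=> // h.
have cE : class_C l U (E \o sigma) := class_C_comp_mx oU oW sW IH (sE l).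
have := class_C_mulmx oU (class_C_cst l U h) cE.
by apply: class_C_eq => // u Uu; rewrite dsE.
Qed.

(** * The pointwise identities *)

(** The matrices w and L and the matrices dw X, dL X, dP X of their directional
    derivatives at one point are treated as abstract data, subject to the
    relations obtained by differentiating w L w = w, L w L = L, P = w L and
    P P = P.  Horizontal vectors are those fixed by w L, and the covectors xi with
    xi L = 0 are those that annihilate them. *)

Section PointwiseAlgebra.
Context {R : realType} {n : nat}.
Implicit Types (X Y Z a b c xi eta : 'rV[R]_n).
Variables (w L : 'M[R]_n) (dw dL dP : 'rV[R]_n -> 'M[R]_n).
Hypothesis LwL : L *m w *m L = L.
Hypotheses (wT : w^T = - w) (LT : L^T = - L).
Hypothesis dLD : forall X Y, dL (X + Y) = dL X + dL Y.
Hypothesis dLT : forall X, (dL X)^T = - dL X.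
Hypothesis dwE : forall X, dw X = dw X *m L *m w + w *m dL X *m w + w *m L *m dw X.
Hypothesis dLE : forall X, dL X = dL X *m w *m L + L *m dw X *m L + L *m w *m dL X.
Hypothesis dPE : forall X, dP X = dw X *m L + w *m dL X.
Hypothesis dPP : forall X, dP X = dP X *m (w *m L) + w *m L *m dP X.

(** The cyclic sum of D_(a L) L (b, c), half of the Schouten bracket of the
    bivector L with itself. *)
Definition jacobiator a b c : R :=
  bil (dL (a *m L)) b c + bil (dL (b *m L)) c a + bil (dL (c *m L)) a b.

Definition dform X Y Z : R := bil (dw X) Y Z + bil (dw Y) Z X + bil (dw Z) X Y.

Lemma bilDl (A : 'M[R]_n) a b c : bil A (a + b) c = bil A a c + bil A b c.
Proof. by rewrite /bil !mulmxDl mxE. Qed.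

Lemma bilDr (A : 'M[R]_n) a b c : bil A c (a + b) = bil A c a + bil A c b.
Proof. by rewrite /bil linearD/= !mulmxDr mxE. Qed.

Lemma bilDm (A B : 'M[R]_n) a b : bil (A + B) a b = bil A a b + bil B a b.
Proof. by rewrite /bil mulmxDr mulmxDl mxE. Qed.

Lemma bil0 a b : bil (0 : 'M[R]_n) a b = 0.
Proof. by rewrite /bil mulmx0 mul0mx mxE. Qed.

Lemma bil_trmx (A : 'M[R]_n) a b : bil A^T a b = bil A b a.
Proof.
rewrite /bil -[b *m A *m a^T]trmxK [in RHS]mxE.
by rewrite !trmx_mul trmxK mulmxA.
Qed.

Lemma bil_skew (A : 'M[R]_n) a b : A^T = - A -> bil A a b = - bil A b a.
Proof. by move=> AT; rewrite -bil_trmx AT /bil mulmxN mulNmx mxE. Qed.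

Lemma dL0 : dL 0 = 0.
Proof. by apply: (addrI (dL 0)); rewrite -dLD !addr0. Qed.

Lemma jacobiatorC a b c : jacobiator a b c = jacobiator b c a.
Proof. by rewrite /jacobiator; ring. Qed.

Lemma jacobiatorD a a' b c :
  jacobiator (a + a') b c = jacobiator a b c + jacobiator a' b c.
Proof. by rewrite /jacobiator mulmxDl dLD bilDm bilDl bilDr; ring. Qed.

Lemma horizontal_trmx X : X *m (w *m L) = X -> L *m w *m X^T = X^T.
Proof.
by move=> XH; rewrite -[in RHS]XH !trmx_mul wT LT mulmxN !mulNmx opprK.
Qed.

Lemma annihilator_trmx xi : xi *m L = 0 -> L *m xi^T = 0.
Proof.
move=> xL; apply: trmx_inj; rewrite trmx_mul trmxK LT mulmxN xL.
by rewrite oppr0 trmx0.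
Qed.

(** Differentiating w = w L w: on covectors coming from the horizontal space the
    derivative of L is that of w. *)
Lemma dL_horizontal X Y Z : X *m (w *m L) = X -> Y *m (w *m L) = Y ->
  bil (dL Z) (X *m w) (Y *m w) = bil (dw Z) X Y.
Proof.
move=> XH YH; rewrite /bil trmx_mul wT mulNmx mulmxN.
have -> : X *m w *m dL Z *m (w *m Y^T) = X *m (w *m dL Z *m w) *m Y^T.
  by rewrite !mulmxA.
have -> : w *m dL Z *m w = dw Z - dw Z *m L *m w - w *m L *m dw Z.
  by rewrite {1}dwE addrAC addrK addrAC subrr add0r.
rewrite !mulmxBr !mulmxBl -[dw Z *m L *m w]mulmxA [X *m (dw Z *m _)]mulmxA.
rewrite -[_ *m (L *m w) *m Y^T]mulmxA (horizontal_trmx YH).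
by rewrite [X *m (w *m L *m _)]mulmxA XH subrr sub0r opprK.
Qed.

Lemma jacobiator_horizontal X Y Z :
  X *m (w *m L) = X -> Y *m (w *m L) = Y -> Z *m (w *m L) = Z ->
  jacobiator (X *m w) (Y *m w) (Z *m w) = dform X Y Z.
Proof.
move=> XH YH ZH; rewrite /jacobiator -!mulmxA XH YH ZH.
by rewrite !dL_horizontal.
Qed.

(** As L kills xi, differentiating P = w L gives X w dL xi^T = X dP xi^T. *)
Lemma jacobiator_mixed X Y xi :
  X *m (w *m L) = X -> Y *m (w *m L) = Y -> xi *m L = 0 ->
  jacobiator (X *m w) (Y *m w) xi = ((Y *m dP X - X *m dP Y) *m xi^T) 0 0.
Proof.
move=> XH YH xL; rewrite /jacobiator -!mulmxA XH YH xL dL0.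
have Lx := annihilator_trmx xL.
have key U V : bil (dL V) (U *m w) xi = (U *m dP V *m xi^T) 0 0.
  rewrite dPE mulmxDr mulmxDl -[U *m (_ *m L) *m _]mulmxA -[dw V *m L *m _]mulmxA.
  by rewrite Lx !mulmx0 add0r /bil !mulmxA.
rewrite [bil (dL Y) xi _]bil_skew// !key mulmxBl !mxE.
by rewrite bil0 addr0.
Qed.

(** Each of the three terms of the derivative of L w L keeps a factor L next to
    one of the two annihilators. *)
Lemma jacobiator_vertical a xi eta : xi *m L = 0 -> eta *m L = 0 ->
  jacobiator a xi eta = 0.
Proof.
move=> xL eL; rewrite /jacobiator xL eL dL0.
have Le := annihilator_trmx eL.
rewrite !bil0 !addr0 /bil dLE !mulmxDr !mulmxDl.
by rewrite -!mulmxA Le !mulmxA xL !(mulmx0, mul0mx, addr0) mxE.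
Qed.

(** The bracket controls Y dP X - X dP Y only through the annihilator of the
    horizontal space, hence modulo that space; but differentiating P P = P shows
    that this vector has no horizontal component. *)
Lemma involutive_defect X Y :
  X *m (w *m L) = X -> Y *m (w *m L) = Y ->
  (forall xi, xi *m L = 0 -> jacobiator (X *m w) (Y *m w) xi = 0) ->
  Y *m dP X = X *m dP Y.
Proof.
move=> XH YH J0; apply/eqP; rewrite -subr_eq0; apply/eqP.
set T := _ - _.
have HP U V : U *m (w *m L) = U -> U *m dP V *m (w *m L) = 0.
  move=> UH; have : U *m dP V = U *m dP V by [].
  rewrite {1}dPP mulmxDr [U *m (w *m L *m _)]mulmxA UH -[RHS]add0r.
  by move=> /addIr; rewrite mulmxA.
have TP : T *m (w *m L) = 0 by rewrite mulmxBl !HP// subrr.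
apply/rowP => j; rewrite [RHS]mxE.
pose xi : 'rV[R]_n := delta_mx 0 j *m (1%:M - L *m w).
have xL : xi *m L = 0 by rewrite -mulmxA mulmxBl mul1mx LwL subrr mulmx0.
have xT : xi^T = (1%:M - w *m L) *m delta_mx j 0.
  rewrite trmx_mul linearB/= trmx1 trmx_mul wT LT mulmxN mulNmx opprK.
  by rewrite trmx_delta.
have := J0 xi xL; rewrite jacobiator_mixed// -/T xT mulmxA mulmxBr mulmx1 TP.
by rewrite subr0 -colE mxE.
Qed.

(** A covector a splits as (a L) w + xi, with a L horizontal and xi in the
    annihilator of the horizontal space. *)
Lemma jacobiator_eq0P :
  (forall a b c, jacobiator a b c = 0) <->
  (forall X Y Z, X *m (w *m L) = X -> Y *m (w *m L) = Y ->
     Z *m (w *m L) = Z -> dform X Y Z = 0) /\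
  (forall X Y, X *m (w *m L) = X -> Y *m (w *m L) = Y ->
     Y *m dP X = X *m dP Y).
Proof.
split=> [J0|[d0 inv] a b c].
  split=> [X Y Z XH YH ZH|X Y XH YH]; first by rewrite -jacobiator_horizontal.
  by apply: involutive_defect => // xi _.
pose ver a := a - a *m L *m w.
have aE a' : a' = a' *m L *m w + ver a' by rewrite addrC subrK.
have HH a' : a' *m L *m (w *m L) = a' *m L by rewrite -mulmxA [L *m _]mulmxA LwL.
have VL a' : ver a' *m L = 0.
  by rewrite mulmxBl -!mulmxA [L *m (w *m L)]mulmxA LwL subrr.
have mixed X Y xi : X *m (w *m L) = X -> Y *m (w *m L) = Y -> xi *m L = 0 ->
    jacobiator (X *m w) (Y *m w) xi = 0.
  by move=> XH YH xL; rewrite jacobiator_mixed// inv// subrr mul0mx mxE.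
have rot a' b' c' : jacobiator c' a' b' = jacobiator a' b' c'.
  exact: jacobiatorC.
have J2 X Y c' : X *m (w *m L) = X -> Y *m (w *m L) = Y ->
    jacobiator (X *m w) (Y *m w) c' = 0.
  move=> XH YH; rewrite -rot [c']aE jacobiatorD [jacobiator (ver c') _ _]rot.
  by rewrite jacobiator_horizontal// d0// mixed// addr0.
have J1 X b' c' : X *m (w *m L) = X -> jacobiator (X *m w) b' c' = 0.
  move=> XH; rewrite jacobiatorC [b']aE jacobiatorD.
  have -> : jacobiator (b' *m L *m w) c' (X *m w) = 0 by rewrite -rot J2.
  rewrite add0r rot [c']aE jacobiatorD J2// add0r rot.
  exact: jacobiator_vertical.
rewrite [a]aE jacobiatorD J1// add0r jacobiatorC.
rewrite [b]aE jacobiatorD J1// add0r rot.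
exact: jacobiator_vertical.
Qed.

End PointwiseAlgebra.

(** * Linear algebra of a bilinear form with complementary kernels *)

Section BilinearForm.
Context {R : realType} {n : nat}.
Variable B : 'M[R]_n.
Let w : 'M[R]_n := 2%:R^-1 *: (B - B^T).
Let S : 'M[R]_n := 2%:R^-1 *: (B + B^T).
Let L : 'M[R]_n := - (invmx B *m w *m (invmx B)^T).
Hypothesis Bunit : B \in unitmx.
Hypothesis HV0 : (kermx S :&: kermx w == (0 : 'M[R]_n))%MS.
Hypothesis HV1 : row_full (kermx S + kermx w)%MS.

(** Identities between matrices are checked on the two complementary kernels. *)
Lemma eq_on_kernels m (A1 A2 : 'M[R]_(n, m)) :
  (forall h : 'M[R]_n, h *m S = 0 -> h *m A1 = h *m A2) ->
  (forall v : 'M[R]_n, v *m w = 0 -> v *m A1 = v *m A2) -> A1 = A2.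
Proof.
move=> AH AV; have : (1%:M <= kermx S + kermx w)%MS by exact: submx_full.
move=> /sub_addsmxP[[D1 D2] /= E1].
rewrite -[A1]mul1mx -[A2]mul1mx E1 !mulmxDl.
rewrite -[D1 *m _ *m A1]mulmxA -[D2 *m _ *m A1]mulmxA.
rewrite -[D1 *m _ *m A2]mulmxA -[D2 *m _ *m A2]mulmxA.
by rewrite (AH _ (mulmx_ker S)) (AV _ (mulmx_ker w)).
Qed.

Lemma sym_skew : B = S + w.
Proof. by apply/matrixP => i j; rewrite !mxE; field. Qed.

Lemma trmx_sym_skew : B^T = S - w.
Proof. by apply/matrixP => i j; rewrite !mxE; field. Qed.

Lemma trmx_skew : w^T = - w.
Proof. by apply/matrixP => i j; rewrite !mxE; ring. Qed.

Lemma trmx_bivector : L^T = - L.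
Proof.
by rewrite /L linearN/= !trmx_mul trmxK trmx_skew mulNmx mulmxN mulmxA.
Qed.

Let BTunit : B^T \in unitmx.
Proof. by rewrite unitmx_tr. Qed.

(** On Ker S the form B is w and its transpose is -w, so h w B^-T = -h. *)
Lemma proj_sym_kernel (h : 'M[R]_n) : h *m S = 0 -> h *m (w *m L) = h.
Proof.
move=> hS; have hw : h *m w = h *m B by rewrite [in RHS]sym_skew mulmxDr hS add0r.
have hw' : h *m w = - (h *m B^T).
  by rewrite trmx_sym_skew mulmxBr hS sub0r opprK.
rewrite mulmxA hw /L mulmxN !mulmxA mulmxK// hw' trmx_inv mulNmx opprK.
by rewrite mulmxK.
Qed.

Lemma proj_skew_kernel (v : 'M[R]_n) : v *m w = 0 -> v *m (w *m L) = 0.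
Proof. by move=> vw; rewrite mulmxA vw mul0mx. Qed.

Lemma skew_geninv : w *m L *m w = w.
Proof.
apply: eq_on_kernels => [h hS|v vw]; first by rewrite mulmxA proj_sym_kernel.
by rewrite mulmxA proj_skew_kernel// mul0mx vw.
Qed.

Lemma form_bivector : B *m L = w *m L.
Proof.
apply: eq_on_kernels => [h hS|v vw].
  by rewrite !mulmxA [in LHS]sym_skew mulmxDr hS add0r.
rewrite proj_skew_kernel// /L !mulmxN !mulmxA mulmxK//.
by rewrite vw mul0mx oppr0.
Qed.

Lemma bivector_geninv : L *m w *m L = L.
Proof.
rewrite -[LHS](mulKmx Bunit) -[RHS](mulKmx Bunit); congr (_ *m _).
by rewrite !mulmxA form_bivector skew_geninv.
Qed.

Lemma proj_fixE m (u : 'M[R]_(m, n)) : (u *m (w *m L) == u) = (u *m S == 0).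
Proof.
apply/eqP/eqP => [<-|uS].
  have -> : w *m L = w *m L *m (w *m L) by rewrite mulmxA skew_geninv.
  rewrite -!mulmxA; suff -> : w *m (L *m S) = 0 by rewrite !mulmx0.
  apply: eq_on_kernels => [h hS|v vw]; rewrite mulmx0 !mulmxA.
    by rewrite -[_ *m w *m L]mulmxA proj_sym_kernel.
  by rewrite vw !mul0mx.
have /submxP[D ->] : (u <= kermx S)%MS by apply/sub_kermxP.
by rewrite -mulmxA proj_sym_kernel// mulmx_ker.
Qed.

Lemma projector_bivector : proj_mx (kermx S) (kermx w) = w *m L.
Proof.
have HV : (kermx S :&: kermx w)%MS = 0.
  by apply/eqP; rewrite -submx0; case/andP: HV0.
apply: eq_on_kernels => [h hS|v vw].
  by rewrite proj_sym_kernel// proj_mx_id//; apply/sub_kermxP.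
by rewrite proj_skew_kernel// proj_mx_0//; apply/sub_kermxP.
Qed.

End BilinearForm.

(** * The Poisson condition in a chart *)

(** For X and Y extended to sections of the distribution, differentiating
    Y P = Y along X shows that the component of [X, Y] outside the distribution is
    Y D_X P - X D_Y P.  The condition therefore expresses involutivity without
    extending the vectors. *)
Definition involutive_at (R : realType) (n : nat) (P : 'rV[R]_n -> 'M[R]_n)
    (x : 'rV[R]_n) : Prop :=
  forall X Y, X *m P x = X -> Y *m P x = Y -> Y *m 'D_X P x = X *m 'D_Y P x.

Section Chart.
Context {R : realType} {n : nat} {M : manifold R n}.
Variable B : tensor02 M.
Hypothesis Bunit : tensor_nondegenerate B.
Hypothesis BHV : tangent_direct_sum (Ker (sym_part B)) (Ker (skew_part B)).

Let w := skew_part B.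
Let L := assoc_bivector B.
(** The projection onto Ker S along Ker w, in a form whose smoothness is
    manifest. *)
Definition horizontal_projector (c : chart M) (x : 'rV[R]_n) : 'M[R]_n :=
  w c x *m L c x.
Let P := horizontal_projector.

Lemma chart_image_open (c : chart M) : open (chart_image c).
Proof. exact: coord_open. Qed.
Let oU := chart_image_open.

Lemma skew_part_smooth c : smooth_on (chart_image c) (w c).
Proof.
move=> k; apply: class_C_scale => //.
have -> : (fun x => Defs.comp B c x - (Defs.comp B c x)^T) =
    (fun x => Defs.comp B c x + (-1) *: (Defs.comp B c x)^T).
  by apply/funext => x; rewrite scaleN1r.
apply: class_C_addmx => //; first exact: comp_smooth.
by apply: class_C_scale => //; apply: class_C_trmx => //; exact: comp_smooth.
Qed.

Lemma bivector_smooth c : smooth_on (chart_image c) (L c).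
Proof.
move=> k; have cV : class_C k (chart_image c) (fun x => invmx (Defs.comp B c x)).
  by apply: class_C_invmx => //; [exact: Bunit|exact: comp_smooth].
rewrite (_ : L c = fun x => (-1) *:
    (invmx (Defs.comp B c x) *m w c x *m (invmx (Defs.comp B c x))^T)); last first.
  by apply/funext => x; rewrite scaleN1r.
apply: class_C_scale => //; apply: class_C_mulmx => //.
  by apply: class_C_mulmx => //; exact: skew_part_smooth.
exact: class_C_trmx.
Qed.

Lemma horizontal_projector_smooth c : smooth_on (chart_image c) (P c).
Proof.
by move=> k; apply: class_C_mulmx => //;
   [exact: skew_part_smooth|exact: bivector_smooth].
Qed.

Lemma horizontal_fix c x m (u : 'M[R]_(m, n)) : chart_image c x ->
  (u *m P c x == u) = (u <= Ker (sym_part B) c x)%MS.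
Proof.
move=> Ux; have [HV0 HV1] := BHV Ux.
by rewrite sub_kermx -(proj_fixE (Bunit Ux) HV1).
Qed.

Lemma pr_horizontal c x : chart_image c x ->
  pr (Ker (sym_part B)) (Ker (skew_part B)) c x = P c x.
Proof.
move=> Ux; have [HV0 HV1] := BHV Ux.
exact: projector_bivector (Bunit Ux) HV0 HV1.
Qed.

Lemma horizontal_idem c x : chart_image c x -> P c x *m P c x = P c x.
Proof.
move=> Ux; have [_ HV1] := BHV Ux.
by rewrite /P /horizontal_projector mulmxA (skew_geninv (Bunit Ux) HV1).
Qed.

Lemma schouten_eq0P c x : chart_image c x ->
  (forall al be ga, schouten L L c x al be ga = 0) <->
  (forall X Y Z, X *m P c x = X -> Y *m P c x = Y -> Z *m P c x = Z ->
     ext_deriv w c x X Y Z = 0) /\ involutive_at (P c) x.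
Proof.
move=> Ux; have [HV0 HV1] := BHV Ux.
have dw : differentiable (w c) x by exact: (skew_part_smooth c 1).1.
have dL : differentiable (L c) x by exact: (bivector_smooth c 1).1.
have dP : differentiable (P c) x by exact: differentiable_mulmx.
have nearU : \forall y \near x, chart_image c y.
  by apply: open_nbhs_nbhs; split => //; exact: oU.
have wLw y : chart_image c y -> w c y *m L c y *m w c y = w c y.
  by move=> Uy; have [_ H] := BHV Uy; exact: skew_geninv (Bunit Uy) H.
have LwL y : chart_image c y -> L c y *m w c y *m L c y = L c y.
  by move=> Uy; have [_ H] := BHV Uy; exact: bivector_geninv (Bunit Uy) H.
have E X : 'D_X (P c) x = 'D_X (w c) x *m L c x + w c x *m 'D_X (L c) x.
  exact: derive_mulmx.
have J := @jacobiator_eq0P R n (w c x) (L c x) (fun X => 'D_X (w c) x)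
  (fun X => 'D_X (L c) x) (fun X => 'D_X (P c) x).
have {}J := J (LwL x Ux) (trmx_skew _) (trmx_bivector _).
have sch al be ga : schouten L L c x al be ga =
    2 * jacobiator (L c x) (fun X => 'D_X (L c) x) al be ga.
  by rewrite /schouten /jacobiator; ring.
transitivity (forall al be ga,
    jacobiator (L c x) (fun X => 'D_X (L c) x) al be ga = 0).
  split=> H al be ga; last by rewrite sch H mulr0.
  by have /eqP := H al be ga; rewrite sch mulf_eq0 pnatr_eq0/= => /eqP.
apply: J.
- by move=> X Y; rewrite !deriveE// linearD.
- move=> X; rewrite -derive_trmx// -deriveN; last exact: diff_derivable.
  by congr (derive _ x X); apply/funext => y; exact: trmx_bivector.
- move=> X; rewrite -mulmxDl -(derive_mulmx X dw dL).
  rewrite -(derive_mulmx X (differentiable_mulmx dw dL) dw).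
  by apply: near_eq_derive; apply: filterS nearU => y Uy; rewrite wLw.
- move=> X; rewrite -mulmxDl -(derive_mulmx X dL dw).
  rewrite -(derive_mulmx X (differentiable_mulmx dL dw) dL).
  by apply: near_eq_derive; apply: filterS nearU => y Uy; rewrite LwL.
- exact: E.
- move=> X; rewrite -[w c x *m L c x]/(P c x) -(derive_mulmx X dP dP).
  by apply: near_eq_derive; apply: filterS nearU => y Uy; rewrite horizontal_idem.
Qed.

Lemma poissonP :
  is_poisson L <->
  vanishes_along (pr (Ker (sym_part B)) (Ker (skew_part B)))
    (ext_deriv (skew_part B)) /\
  (forall c x, chart_image c x -> involutive_at (P c) x).
Proof.
split=> [poi|[van inv] c x Ux].
  split=> [c x Ux X Y Z|c x Ux]; have /(schouten_eq0P Ux)[d0 inv] := poi c x Ux.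
    by rewrite pr_horizontal// d0// -mulmxA horizontal_idem.
  exact: inv.
apply/(schouten_eq0P Ux); split; last exact: inv.
move=> X Y Z XH YH ZH; have := van c x Ux X Y Z.
by rewrite pr_horizontal// XH YH ZH.
Qed.

End Chart.

(** * Integral manifolds of an involutive distribution *)

Lemma jacobian_comp (R : realType) (k n m : nat) (f : 'rV[R]_k -> 'rV[R]_n)
    (g : 'rV[R]_n -> 'rV[R]_m) (x : 'rV[R]_k) :
  differentiable f x -> differentiable g (f x) ->
  jacobian (g \o f) x = jacobian f x *m jacobian g (f x).
Proof.
move=> df dg; apply/row_matrixP => i; rewrite !rowE.
have dgf := differentiable_comp df dg.
apply: etrans (esym (deriveEjacobian _ dgf)) _.
apply: etrans (derive_comp _ df dg) _.
apply: etrans (deriveEjacobian _ dg) _.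
by rewrite (deriveEjacobian _ df) mulmxA.
Qed.

Section Frobenius.
Context {R : realType} {n : nat}.

(** The tangency condition D_h F * P(F) = D_h F, differentiated in a second
    direction and antisymmetrised, leaves only the derivative of P. *)
Lemma involutive_of_integral (k : nat) (U : set 'rV[R]_k)
    (F : 'rV[R]_k -> 'rV[R]_n) (P : 'rV[R]_n -> 'M[R]_n) (u : 'rV[R]_k) :
  open U -> class_C 2 U F -> U u -> differentiable P (F u) ->
  (forall v h, U v -> 'D_h F v *m P (F v) = 'D_h F v) ->
  (forall X, X *m P (F u) = X -> exists h, X = 'D_h F u) ->
  involutive_at P (F u).
Proof.
move=> oU cF Uu dP FP onto X Y /onto[g ->] /onto[h ->].
have dF : differentiable F u by exact: cF.1.
have dDF a : differentiable ('D_a F) u by exact: (cF.2 a).1.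
have key a b : 'D_a ('D_b F) u =
    'D_a ('D_b F) u *m P (F u) + 'D_b F u *m 'D_('D_a F u) P (F u).
  rewrite -(derive_comp _ dF dP).
  rewrite -(derive_mulmx _ (dDF b) (differentiable_comp dF dP)).
  apply: near_eq_derive.
  apply: filterS (open_nbhs_nbhs (conj oU Uu)) => v Uv.
  by rewrite /= FP.
have cancel (A A' C C' : 'rV[R]_n) (Q : 'M[R]_n) : A = A *m Q + C ->
    A' = A' *m Q + C' -> A = A' -> C = C'.
  by move=> AE AE' e; apply: (addrI (A *m Q)); rewrite -AE e -AE'.
exact: cancel (key g h) (key h g) (derive_sym_mx h g oU cF Uu).
Qed.

Lemma unit_neighbourhood (k : nat) (W : set 'rV[R]_n)
    (A : 'rV[R]_n -> 'M[R]_k) : open W -> class_C 0 W A ->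
  open (W `&` [set y | A y \in unitmx]).
Proof.
move=> oW cA; rewrite openE => y [Wy uy].
have cdet : {for y, continuous (fun z => \det (A z))}.
  by apply: (class_C_det oW cA).
have dy : \det (A y) != 0 by rewrite -unitfE -unitmxE.
have near_det : \forall z \near y, \det (A z) != 0.
  exact: cvgr_neq0 cdet dy.
have near_W : \forall z \near y, W z by apply: open_nbhs_nbhs.
near=> z; split; first by near: z.
by rewrite /= unitmxE unitfE; near: z.
Unshelve. all: by end_near. Qed.

(** A frame E0 of an involutive distribution, rescaled so that E pi = 1 for a
    constant matrix pi, consists of commuting vector fields: their brackets lie
    in the distribution and are killed by pi. *)
Lemma frobenius_frame (k : nat) (W : set 'rV[R]_n)
    (E0 : 'rV[R]_n -> 'M[R]_(k, n)) (P : 'rV[R]_n -> 'M[R]_n) (x0 : 'rV[R]_n) :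
  open W -> W x0 -> smooth_on W E0 -> row_free (E0 x0) ->
  (forall y, W y -> differentiable P y) ->
  (forall y, W y -> involutive_at P y) ->
  (forall y m (u : 'M[R]_(m, n)), W y ->
     (u *m P y == u) = (u <= E0 y)%MS) ->
  exists (W' : set 'rV[R]_n) (E : 'rV[R]_n -> 'M[R]_(k, n)) (pi : 'M[R]_(n, k)),
    [/\ open W', W' x0, W' `<=` W, smooth_on W' E & [/\
      forall y, W' y -> (E y :=: E0 y)%MS,
      forall y, W' y -> E y *m pi = 1%:M
    & forall y (u h : 'rV[R]_k), W' y ->
        h *m 'D_(u *m E y) E y = u *m 'D_(h *m E y) E y]].
Proof.
move=> oW Wx0 sE0 free0 dP inv PE.
(* Any right inverse of E0 at x0 works: E0 pi is invertible at x0, hence nearby. *)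
pose pi := pinvmx (E0 x0).
pose A y := E0 y *m pi.
have sA : smooth_on W A.
  by move=> l; apply: class_C_mulmx => //; exact: class_C_cst.
pose W' := W `&` [set y | A y \in unitmx].
have oW' : open W' by exact: unit_neighbourhood (sA 0%N).
have subW : W' `<=` W by move=> y [].
pose E y := invmx (A y) *m E0 y.
have sE : smooth_on W' E.
  move=> l; apply: class_C_mulmx => //.
    apply: class_C_invmx => //; first by move=> y [].
    exact: class_C_sub subW (sA l).
  exact: class_C_sub subW (sE0 l).
have EE0 y : W' y -> (E y :=: E0 y)%MS.
  move=> [_ uA]; apply: eqmxMfull; rewrite row_full_unit.
  by rewrite unitmx_inv.
have Epi y : W' y -> E y *m pi = 1%:M.
  by move=> [_ uA]; rewrite -mulmxA mulVmx.
exists W', E, pi; split; [exact: oW'| |exact: subW|exact: sE|].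
  by split => //=; rewrite /A mulmxVp ?unitmx1.
split; [exact: EE0|exact: Epi|] => y u h W'y; have [Wy uA] := W'y.
have dE : differentiable E y by exact: (sE 1%N).1.
have dPy := dP y Wy.
have near_W' : \forall z \near y, W' z by apply: open_nbhs_nbhs.
have EP z m (a : 'M[R]_(m, k)) : W' z -> a *m E z *m P z = a *m E z.
  move=> W'z; apply/eqP; rewrite PE; last by case: W'z.
  by rewrite -(EE0 z W'z) submxMl.
have DE X : 'D_X E y = 'D_X E y *m P y + E y *m 'D_X P y.
  rewrite -(derive_mulmx _ dE dPy); apply: near_eq_derive.
  apply: filterS near_W' => z W'z.
  by have := EP z k 1%:M W'z; rewrite mul1mx => ->.
have DEpi X : 'D_X E y *m pi = 0.
  have dpi : differentiable (fun=> pi : 'M[R]_(n, k)) y.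
    exact: differentiable_cst.
  have E1 : 'D_X (fun z => E z *m pi) y = 'D_X (fun=> 1%:M) y.
    by apply: near_eq_derive; apply: filterS near_W' => z; exact: Epi.
  have E2 := derive_mulmx X dE dpi; rewrite E1 !derive_cst mulmx0 addr0 in E2.
  exact: esym E2.
(* T is the bracket of the fields u E and h E, up to sign. *)
apply/eqP; rewrite -subr_eq0; apply/eqP; set T := _ - _.
have TP : T *m P y = T.
  have cancel (A1 A2 C : 'rV[R]_n) (Q : 'M[R]_n) : A1 = A1 *m Q + C ->
      A2 = A2 *m Q + C -> (A1 - A2) *m Q = A1 - A2.
    by move=> e1 e2; rewrite mulmxBl {2}e1 {2}e2 opprD addrACA subrr addr0.
  have hDE (a b : 'rV[R]_k) : b *m 'D_(a *m E y) E y =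
      b *m 'D_(a *m E y) E y *m P y + b *m E y *m 'D_(a *m E y) P y.
    by rewrite {1}DE mulmxDr !mulmxA.
  apply: cancel (hDE u h) _.
  rewrite (inv y Wy (u *m E y) (h *m E y)); [exact: hDE|exact: EP|exact: EP].
have /submxP[a Ta] : (T <= E y)%MS.
  by rewrite (EE0 y W'y) -PE// TP.
have hpi X (b : 'rV[R]_k) : b *m 'D_X E y *m pi = 0 by rewrite -mulmxA DEpi mulmx0.
have : T *m pi = 0.
  apply: etrans (mulmxBl _ _ _) _.
  by apply: etrans (congr2 (fun a b => a - b) (hpi _ h) (hpi _ u)) _; exact: subrr.
by rewrite Ta -mulmxA Epi// mulmx1 => ->; rewrite mul0mx.
Qed.

(** The map sigma of [flow_map] for the rescaled frame E parametrises the integral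
    manifold: its Jacobian is E(sigma), which has the row space of E0(sigma). *)
Lemma frobenius_local (k : nat) (W : set 'rV[R]_n)
    (E0 : 'rV[R]_n -> 'M[R]_(k, n)) (P : 'rV[R]_n -> 'M[R]_n) (x0 : 'rV[R]_n) :
  open W -> W x0 -> smooth_on W E0 ->
  (forall y, W y -> row_free (E0 y)) ->
  (forall y, W y -> differentiable P y) ->
  (forall y, W y -> involutive_at P y) ->
  (forall y m (u : 'M[R]_(m, n)), W y ->
     (u *m P y == u) = (u <= E0 y)%MS) ->
  exists (U : set 'rV[R]_k) (sigma : 'rV[R]_k -> 'rV[R]_n),
    [/\ open U, U 0, sigma 0 = x0, smooth_on U sigma & [/\
      forall u, U u -> W (sigma u),
      forall u v, U u -> U v -> sigma u = sigma v -> u = v,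
      forall u, U u -> row_free (jacobian sigma u)
    & forall u, U u -> (jacobian sigma u :=: E0 (sigma u))%MS]].
Proof.
move=> oW Wx0 sE0 free dP inv PE.
have [W' [E [pi [oW' W'x0 sW' sE [EE0 Epi Ecomm]]]]] :=
  frobenius_frame oW Wx0 sE0 (free x0 Wx0) dP inv PE.
have [r r0 sW'r] : exists2 r : R, 0 < r &
    forall y, `|x0 - y| <= r -> W' y.
  have /nbhs_closedballP[r rW'] : nbhs x0 W' by exact: open_nbhs_nbhs.
  exists r%:num => // y yr; apply: rW'.
  by rewrite closed_ballE.
have [d [sigma [d0 s0 Hs]]] := flow_map oW' r0 sW'r sE Epi Ecomm.
have UE : [set u : 'rV[R]_k | `|u| < d] = ball 0 d.
  by rewrite -ball_normE; apply/seteqP; split=> u /=; rewrite sub0r normrN.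
have oU : open [set u : 'rV[R]_k | `|u| < d] by rewrite UE; exact: ball_open.
have JE u : `|u| < d -> jacobian sigma u = E (sigma u).
  move=> /Hs[_ ds dsE _]; apply/row_matrixP => i.
  by rewrite !rowE -deriveEjacobian// dsE.
exists [set u | `|u| < d], sigma; split; [exact: oU| |exact: s0| |].
- by rewrite /= normr0.
- apply: (smooth_of_derive oU oW' sE).
  + by move=> u /Hs[].
  + by move=> u /Hs[].
  + by move=> u h /Hs[_ _ /(_ h)].
split.
- by move=> u /Hs[/sW'].
- move=> u v /Hs[_ _ _ su] /Hs[_ _ _ sv] suv; rewrite suv sv in su.
  by move/addrI : su.
- move=> u ud; have [W'u _ _ _] := Hs u ud; rewrite JE//.
  by rewrite /row_free (EE0 _ W'u); exact/free/sW'.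
- by move=> u ud; have [W'u _ _ _] := Hs u ud; rewrite JE//; exact: EE0.
Qed.

End Frobenius.

(** * Integrability of the kernel of the symmetric part *)

Local Notation coord := Defs.coord.

Section Manifold.
Context {R : realType} {n : nat} {M : manifold R n}.
Implicit Types c d : chart M.

Lemma paramK c x : chart_image c x -> coord c (param c x) = x.
Proof. by move=> [p cp <-]; rewrite coordK. Qed.

Lemma dom_param c x : chart_image c x -> dom c (param c x).
Proof. by move=> [p cp <-]; rewrite coordK. Qed.

Lemma overlap_image c d : coord c @` (dom c `&` dom d) =
  [set x | chart_image c x /\ dom d (param c x)].
Proof.
apply/seteqP; split=> [_ [p [cp dp] <-]|x [cx dx]] /=.
  by rewrite coordK//; split => //; exists p.
by exists (param c x); [split => //; exact: dom_param|exact: paramK].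
Qed.

Lemma overlap_open c d : open (coord c @` (dom c `&` dom d)).
Proof.
rewrite overlap_image openE => x [cx dx].
have near_d : \forall y \near x, dom d (param c y).
  by apply: (param_cont cx); apply: open_nbhs_nbhs; split => //; exact: dom_open.
have near_c : \forall y \near x, chart_image c y.
  by apply: open_nbhs_nbhs; split => //; exact: coord_open.
by near=> y; split; near: y.
Unshelve. all: by end_near. Qed.

Lemma transition_diff c d p : dom c p -> dom d p ->
  differentiable (coord d \o param c) (coord c p).
Proof. by move=> cp dp; apply: (transition_smooth c d 1%N).1; exists p. Qed.

(** The two transition maps between overlapping charts are mutually inverse near
    the point. *)
Lemma transition_unit c d p : dom c p -> dom d p ->
  jacobian (coord d \o param c) (coord c p) \in unitmx.
Proof.
move=> cp dp; set x := coord c p; set y := coord d p.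
have td : differentiable (coord d \o param c) x by exact: transition_diff.
have tc : differentiable (coord c \o param d) y by exact: transition_diff.
have xy : (coord d \o param c) x = y by rewrite /= coordK.
have DD v : 'D_('D_v (coord d \o param c) x) (coord c \o param d) y = v.
  rewrite -xy in tc *; rewrite -(derive_comp _ td tc) -[RHS](derive_id x).
  apply: near_eq_derive.
  have Ux : (coord c @` (dom c `&` dom d)) x by exists p.
  have nU : nbhs x (coord c @` (dom c `&` dom d)).
    by apply: open_nbhs_nbhs; split; [exact: overlap_open|].
  by apply: filterS nU => _ [q [cq dq] <-]; rewrite /= !coordK.
have inverse (J J' : 'M[R]_n) :
    (forall v, v *m J = 'D_v (coord d \o param c) x) ->
    (forall v, v *m J' = 'D_v (coord c \o param d) y) -> J \in unitmx.
  move=> e1 e2; suff JJ : J *m J' = 1%:M by exact: (mulmx1_unit JJ).1.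
  by apply/row_matrixP => i; rewrite !rowE mulmxA e1 e2 DD mulmx1.
apply: (inverse _ (jacobian (coord c \o param d) y)) => v.
  by rewrite (deriveEjacobian v td).
by rewrite (deriveEjacobian v tc).
Qed.

End Manifold.

Section Integrability.
Context {R : realType} {n : nat} {M : manifold R n}.
Variable B : tensor02 M.
Hypothesis Bunit : tensor_nondegenerate B.
Hypothesis BHV : tangent_direct_sum (Ker (sym_part B)) (Ker (skew_part B)).
Let H := Ker (sym_part B).
Let P := horizontal_projector B.

Lemma sym_part_change c d p : dom c p -> dom d p ->
  let J := jacobian (coord d \o param c) (coord c p) in
  sym_part B c (coord c p) = J *m sym_part B d (coord d p) *m J^T.
Proof.
move=> cp dp J; rewrite /sym_part (comp_change B cp dp) -/J.
rewrite !trmx_mul trmxK -scalemxAr -scalemxAl; congr (_ *: _).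
by rewrite mulmxDr mulmxDl !mulmxA.
Qed.

(** The change-of-chart rule S_c = J S_d J^T, with J invertible, makes the kernel
    of S a well-defined distribution. *)
Lemma Ker_change c d p : dom c p -> dom d p ->
  let J := jacobian (coord d \o param c) (coord c p) in
  (H c (coord c p) *m J :=: H d (coord d p))%MS.
Proof.
move=> cp dp J; have uJ : J \in unitmx by exact: transition_unit.
have uJT : J^T \in unitmx by rewrite unitmx_tr.
have SE := sym_part_change cp dp; rewrite -/J in SE.
apply/eqmxP/andP; split.
  apply/sub_kermxP.
  have : H c (coord c p) *m sym_part B c (coord c p) = 0 by exact: mulmx_ker.
  rewrite SE !mulmxA => E0.
  by rewrite -[LHS](mulmxK uJT) E0 mul0mx.
have -> : H d (coord d p) = H d (coord d p) *m invmx J *m J by rewrite mulmxKV.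
apply: submxMr; apply/sub_kermxP.
rewrite SE !mulmxA mulmxKV//.
have -> : H d (coord d p) *m sym_part B d (coord d p) = 0 by exact: mulmx_ker.
by rewrite mul0mx.
Qed.

Lemma integrable_involutive : integrable_distribution H ->
  forall c x, chart_image c x -> involutive_at (P c) x.
Proof.
move=> int c _ [p cp <-].
have [k [U [s [[oU cs _ sms jac] [u Uu sup]]]]] := int p.
pose U' := U `&` s @^-1` dom c.
have oU' : open U'.
  rewrite openE => v [Uv cv].
  have near_U : \forall z \near v, U z by apply: open_nbhs_nbhs.
  have near_c : \forall z \near v, dom c (s z).
    by apply: (cs v Uv); apply: open_nbhs_nbhs; split => //; exact: dom_open.
  by near=> z; split; near: z.
have U'u : U' u by split => //; rewrite /= sup.
have cF : smooth_on U' (coord c \o s) by exact: sms.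
have imF v : U' v -> chart_image c ((coord c \o s) v).
  by move=> [_ cv]; exists (s v).
have dF v h : U' v -> 'D_h (coord c \o s) v = h *m jacobian (coord c \o s) v.
  by move=> U'v; rewrite -deriveEjacobian//; exact: (cF 1%N).1.
have -> : coord c p = (coord c \o s) u by rewrite /= sup.
apply: (involutive_of_integral oU' (cF 2%N) U'u).
- exact: (horizontal_projector_smooth Bunit c 1%N).1 (imF u U'u).
- move=> v h U'v; apply/eqP; rewrite (horizontal_fix Bunit BHV _ (imF v U'v)).
  rewrite dF//; have [Uv cv] := U'v; have [_ /eqmxP JE] := jac c v Uv cv.
  by rewrite -/H -JE submxMl.
- move=> X /eqP; rewrite (horizontal_fix Bunit BHV _ (imF u U'u)).
  have [_ cu] := U'u; have [_ /eqmxP JE] := jac c u Uu cu.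
  by rewrite -/H -JE => /submxP[h ->]; exists h; rewrite dF.
Unshelve. all: by end_near. Qed.

Lemma involutive_integrable : subbundle H ->
  (forall c x, chart_image c x -> involutive_at (P c) x) ->
  integrable_distribution H.
Proof.
move=> subH inv p; have [c cp] := dom_cover p.
have cx0 : chart_image c (coord c p) by exists p.
have [k [W [E [oW Wx0 sW sE EH]]]] := subH c _ cx0.
have PE y m (u : 'M[R]_(m, n)) : W y ->
    (u *m P c y == u) = (u <= E y)%MS.
  move=> Wy; rewrite (horizontal_fix Bunit BHV u (sW y Wy)).
  by have [_ /eqmxP EE] := EH y Wy; rewrite EE.
have [U [sigma [oU U0 s0 ss [sigW inj free JE]]]] :=
  @frobenius_local R n k W E (P c) (coord c p) oW Wx0 sE
    (fun y Wy => (EH y Wy).1)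
    (fun y Wy => (horizontal_projector_smooth Bunit c 1%N).1 y (sW y Wy))
    (fun y Wy => inv c y (sW y Wy)) PE.
have imU u : U u -> chart_image c (sigma u) by move=> Uu; apply/sW/sigW.
have ds u : U u -> differentiable sigma u by exact: (ss 1%N).1.
have cs u : U u -> {for u, continuous (param c \o sigma)}.
  move=> Uu; apply: continuous_comp.
    exact: differentiable_continuous (ds u Uu).
  exact: param_cont (imU u Uu).
exists k, U, (param c \o sigma); split; last first.
  by exists 0 => //=; rewrite s0 coordK.
split; [exact: oU|exact: cs| | |].
- move=> u v Uu Uv /= suv; apply: inj => //.
  by rewrite -(paramK (imU u Uu)) suv paramK//; exact: imU.
- move=> d l; pose U' := U `&` (param c \o sigma) @^-1` dom d.
  have oU' : open U'.
    rewrite openE => v [Uv cv].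
    have near_U : \forall z \near v, U z by apply: open_nbhs_nbhs.
    have near_d : \forall z \near v, dom d ((param c \o sigma) z).
      apply: (cs v Uv); apply: open_nbhs_nbhs.
      by split => //; exact: dom_open.
    by near=> z; split; near: z.
  have sU' u : U' u -> (coord c @` (dom c `&` dom d)) (sigma u).
    by move=> [Uu du]; rewrite overlap_image; split => //; exact: imU.
  have sub : U' `<=` U by move=> u [].
  have H1 : class_C l U' sigma := class_C_sub sub (ss l).
  have H2 : class_C l (coord c @` (dom c `&` dom d)) (coord d \o param c) :=
    transition_smooth c d l.
  exact: (class_C_comp_mx oU' (@overlap_open _ _ _ c d) sU' H1 H2).
- move=> d u Uu du; set q := param c (sigma u) in du.
  have cq : dom c q by exact/dom_param/imU.
  have sq : sigma u = coord c q by rewrite /q paramK//; exact: imU.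
  have td := transition_diff cq du; rewrite -sq in td.
  have dsu := ds u Uu.
  have JC : jacobian (coord d \o (param c \o sigma)) u =
      jacobian sigma u *m jacobian (coord d \o param c) (coord c q).
    by rewrite -sq; exact: (jacobian_comp (g := coord d \o param c) dsu td).
  rewrite JC.
  have uJ := transition_unit cq du.
  have Jeq : (jacobian sigma u :=: H c (coord c q))%MS.
    apply: (eqmx_trans (JE u Uu)); apply/eqmxP.
    by rewrite -sq; exact: (EH _ (sigW u Uu)).2.
  split.
    rewrite /row_free mxrankMfree ?row_free_unit//.
    exact: free u Uu.
  apply/eqmxP; apply: eqmx_trans (eqmxMr _ Jeq) _.
  by rewrite /= -/q; exact: Ker_change.
Unshelve. all: by end_near. Qed.

End Integrability.

Theorem theorem4p7 (R : realType) (n : nat) (M : manifold R n) (B : tensor02 M) :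
  let omega := skew_part B in
  let S := sym_part B in
  let H := Ker S in
  let V := Ker omega in
  tensor_nondegenerate B ->
  subbundle H ->
  subbundle V ->
  tangent_direct_sum H V ->
  (is_poisson (assoc_bivector B) <->
   vanishes_along (pr H V) (ext_deriv omega) /\ integrable_distribution H).
Proof.
move=> w S H V Bunit subH _ HV; have [P1 P2] := poissonP Bunit HV.
split=> [/P1[van inv]|[van int]].
  by split; [exact: van|exact: involutive_integrable Bunit HV subH inv].
by apply: P2; split; [exact: van|exact: integrable_involutive Bunit HV int].
Qed.
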